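(* Let $(B,+,\circ)$ be a Dedekind skew brace having a finite series of ideals whose factors are trivial skew braces. (This condition holds in particular when $B$ is soluble, or left nilpotent, or right nilpotent.) Then: (1) $B$ is soluble. (2) If either $\pi(B,+)$ or $\pi(B,\circ)$ is finite, and $(B,+)$ has finite Hirsch length, then $B$ is centrally nilpotent. In particular, if either $(B,+)$ or $(B,\circ)$ is a $p$-group for some prime $p$, then $B$ is centrally nilpotent.
   Context: A skew brace is a triple $(B,+,\circ)$ with $(B,+)$, $(B,\circ)$ (not necessarily abelian) groups such that $a\circ(b+c)=a\circ b-a+a\circ c$ for all $a,b,c\in B$. The identities of the two groups coincide and are denoted by $0$. For $a\in B$ put $\lambda_a(b)=-a+a\circ b$; then $\lambda:a\mapsto\lambda_a$ is a homomorphism $(B,\circ)\to\operatorname{Aut}(B,+)$. Put $a\ast b=-a+a\circ b-b$, and for $X,Y\subseteq B$ let $X\ast Y$ be the subgroup of $(B,+)$ generated by all $x\ast y$ with $x\in X$, $y\in Y$. A sub-skew brace is a subset that is a subgroup of both $(B,+)$ and $(B,\circ)$. An ideal is a subgroup of $(B,+)$ that is normal in $(B,+)$, invariant under all $\lambda_b$, and normal in $(B,\circ)$; one can form the quotient skew brace $B/I$. $B$ is Dedekind if all its sub-skew braces are ideals of $B$. $B$ is trivial (a ''group'') if $a+b=a\circ b$ for all $a,b\in B$, and abelian if it is trivial and $(B,+)$ is abelian. $B$ is soluble if it has a finite series of ideals $\{0\}=B_0\leq\dots\leq B_n=B$ with abelian factors. $B$ is left nilpotent if $B\ast(B\ast(\cdots\ast(B\ast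 B))\cdots)=\{0\}$ for some number $n$ of factors, and right nilpotent if $(\cdots((B\ast B)\ast B)\cdots)\ast B=\{0\}$ for some number $n$ of factors. The centre is $Z(B)=\operatorname{Ker}(\lambda)\cap Z(B,+)\cap Z(B,\circ)$; the upper central series is $Z_0(B)=\{0\}$, $Z_{k+1}(B)/Z_k(B)=Z(B/Z_k(B))$; $B$ is centrally nilpotent if $B=Z_n(B)$ for some non-negative integer $n$. For a group $G$, $\pi(G)$ is the set of primes $p$ such that $G$ has an element of order $p$. A group has finite Hirsch length if it has a finite series whose factors are either infinite cyclic or periodic (the number of infinite cyclic factors is then an invariant, the Hirsch length). *)

(* Defs.v *)
From HB Require Import structures.
From mathcomp Require Import all_boot.
From mathcomp Require Import boolp classical_sets functions cardinality.

Set Implicit Arguments.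
Unset Strict Implicit.
Unset Printing Implicit Defensive.

Local Open Scope classical_set_scope.
Local Open Scope quotient_scope.
Local Open Scope group_scope.

Definition is_subgroup (G : groupType) (H : set G) : Prop :=
  [/\ H 1,
      forall x y, H x -> H y -> H (x * y)
    & forall x, H x -> H x^-1].

Definition is_normal (G : groupType) (N : set G) : Prop :=
  is_subgroup N /\ forall x g, N x -> N (x ^ g).

Definition generated (G : groupType) (X : set G) : set G :=
  smallest (@is_subgroup G) X.

Definition group_center (G : groupType) : set G :=
  [set x | forall y, commute x y].
Arguments group_center G : clear implicits.

Definition has_order (G : groupType) (x : G) (n : nat) : Prop :=
  [/\ (0 < n)%N, x ^+ n = 1 & forall m, (0 < m < n)%N -> x ^+ m <> 1].

Definition pi_group (G : groupType) : set nat :=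
  [set p | prime p /\ exists x : G, has_order x p].

Definition is_pgroup (p : nat) (G : groupType) : Prop :=
  forall x : G, exists k : nat, has_order x (p ^ k)%N.

Definition periodic (G : groupType) : Prop :=
  forall x : G, exists n : nat, has_order x n.

Definition infinite_cyclic (G : groupType) : Prop :=
  infinite_set [set: G] /\ exists g : G, generated [set g] = [set: G].

Record subgroup (G : groupType) :=
  Subgroup { subgroup_set :> set G; subgroupP : is_subgroup subgroup_set }.

Record normal_subgroup (G : groupType) :=
  NormalSubgroup { normal_set :> set G; normalP : is_normal normal_set }.

Section SubgroupType.
Variables (G : groupType) (H : subgroup G).

Definition subgroup_type : Type := set_type H.

HB.instance Definition _ := SubChoice.on subgroup_type.

Lemma subgroup_group_closed : group_closed [pred x | x \in (H : set G)].
Proof.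
case: H => S [h1 hM hV] /=; split; first by rewrite inE.
by move=> x y; rewrite !inE => Sx Sy; apply: hM => //; apply: hV.
Qed.

HB.instance Definition _ :=
  SubChoice_isSubGroup.Build G _ subgroup_type subgroup_group_closed.

End SubgroupType.

Section QuotientGroup.
Variables (G : groupType) (N : normal_subgroup G).

Local Notation NS := (normal_set N).

Let N1 : NS 1. Proof. by case: (normalP N) => [[]]. Qed.
Let NM x y : NS x -> NS y -> NS (x * y).
Proof. by case: (normalP N) => [[_ h _] _]; apply: h. Qed.
Let NV x : NS x -> NS x^-1.
Proof. by case: (normalP N) => [[_ _ h] _]; apply: h. Qed.
Let NJ x g : NS x -> NS (x ^ g).
Proof. by case: (normalP N) => [_ h]; apply: h. Qed.

Definition coset_rel : rel G := [rel x y | `[< NS (x^-1 * y) >]].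

Lemma coset_rel_refl : reflexive coset_rel.
Proof. by move=> x; apply/asboolP; rewrite mulVg. Qed.

Lemma coset_rel_sym : symmetric coset_rel.
Proof.
suff h x y : NS (x^-1 * y) -> NS (y^-1 * x).
  by move=> x y; apply/asboolP/asboolP; apply: h.
by move=> /NV; rewrite invgM invgK.
Qed.

Lemma coset_rel_trans : transitive coset_rel.
Proof.
move=> y x z /asboolP xy /asboolP yz; apply/asboolP.
by have := NM xy yz; rewrite -mulgA mulVKg.
Qed.

Definition coset_equiv : equiv_rel G :=
  EquivRel coset_rel coset_rel_refl coset_rel_sym coset_rel_trans.

Lemma coset_relM x x' y y' :
  coset_rel x x' -> coset_rel y y' -> coset_rel (x * y) (x' * y').
Proof.
move=> /asboolP xx' /asboolP yy'; apply/asboolP.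
have := NM (NJ y xx') yy'.
by rewrite conjgE invgM !mulgA mulgK.
Qed.

Lemma coset_relV x x' : coset_rel x x' -> coset_rel x^-1 x'^-1.
Proof.
move=> /asboolP /NV /(NJ x^-1) xx'; apply/asboolP; move: xx'.
by rewrite conjgE invgM !invgK !mulgA mulgK.
Qed.

Definition quotient_group : Type := {eq_quot coset_equiv}.

HB.instance Definition _ := Choice.on quotient_group.
HB.instance Definition _ := EqQuotient.on quotient_group.

Lemma eq_coset (x y : G) :
  \pi_quotient_group x = \pi_quotient_group y <-> NS (x^-1 * y).
Proof. by split=> [/eqmodP /asboolP//|h]; apply/eqmodP/asboolP. Qed.

Definition quotient_mul (X Y : quotient_group) : quotient_group :=
  \pi_quotient_group (repr X * repr Y).
Definition quotient_one : quotient_group := \pi_quotient_group 1.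
Definition quotient_inv (X : quotient_group) : quotient_group :=
  \pi_quotient_group (repr X)^-1.

Let relK x : coset_rel (repr (\pi_quotient_group x)) x.
Proof. by apply/(@eqmodP _ coset_equiv); rewrite reprK. Qed.

Lemma pi_mul : {morph \pi_quotient_group : x y / x * y >-> quotient_mul x y}.
Proof.
move=> x y; apply/(@eqmodP _ coset_equiv).
by rewrite equiv_sym; apply: coset_relM; apply: relK.
Qed.

Lemma pi_inv : {morph \pi_quotient_group : x / x^-1 >-> quotient_inv x}.
Proof.
move=> x; apply/(@eqmodP _ coset_equiv).
by rewrite equiv_sym; apply: coset_relV; apply: relK.
Qed.

Let quotient_mulA : associative quotient_mul.
Proof.
elim/quotW=> x; elim/quotW=> y; elim/quotW=> z.
by rewrite -(pi_mul y z) -(pi_mul x y) -(pi_mul x) -(pi_mul _ z) mulgA.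
Qed.
Let quotient_mul1g : left_id quotient_one quotient_mul.
Proof. by elim/quotW=> x; rewrite -(pi_mul 1 x) mul1g. Qed.
Let quotient_mulg1 : right_id quotient_one quotient_mul.
Proof. by elim/quotW=> x; rewrite -(pi_mul x 1) mulg1. Qed.
Let quotient_mulVg : left_inverse quotient_one quotient_inv quotient_mul.
Proof. by elim/quotW=> x; rewrite -(pi_inv x) -(pi_mul x^-1 x) mulVg. Qed.
Let quotient_mulgV : right_inverse quotient_one quotient_inv quotient_mul.
Proof. by elim/quotW=> x; rewrite -(pi_inv x) -(pi_mul x x^-1) mulgV. Qed.

HB.instance Definition _ :=
  isGroup.Build quotient_group quotient_mulA quotient_mul1g quotient_mulg1
    quotient_mulVg quotient_mulgV.

End QuotientGroup.

(* A finite subnormal series 1 = S 0 <= ... <= S n = G; the normality of S i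
   in S i.+1 is contained in the existence of [N], and the factor
   S i.+1 / S i is [quotient_group N]. *)
Definition finite_Hirsch_length (G : groupType) : Prop :=
  exists (n : nat) (S : nat -> subgroup G),
    [/\ (S 0%N : set G) = [set 1],
        (S n : set G) = [set: G]
      & forall i, (i < n)%N ->
        (S i : set G) `<=` S i.+1 /\
        exists N : normal_subgroup (subgroup_type (S i.+1)),
          (N : set _) = [set x | (S i : set G) (val x)] /\
          (infinite_cyclic (quotient_group N) \/
           periodic (quotient_group N))].

(* The group (B, o) is the [groupType] structure of B, so a o b is [a * b]; the
   group (B, +), which need not be abelian, is given by its own operations. *)
HB.mixin Record isSkewBrace B of Group B := {
  badd : B -> B -> B;
  bzero : B;
  bopp : B -> B;
  baddA : associative badd;
  badd0l : left_id bzero badd;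
  badd0r : right_id bzero badd;
  baddNl : left_inverse bzero bopp badd;
  baddNr : right_inverse bzero bopp badd;
  brace_distr : forall a b c : B,
    a * badd b c = badd (badd (a * b) (bopp a)) (a * c)
}.

#[short(type="skewBraceType")]
HB.structure Definition SkewBrace := { B of isSkewBrace B & Group B }.

Declare Scope brace_scope.
Delimit Scope brace_scope with brace.
Notation "0" := bzero : brace_scope.
Notation "a + b" := (badd a b) : brace_scope.
Notation "- a" := (bopp a) : brace_scope.
Notation "a - b" := (badd a (bopp b)) : brace_scope.
Local Open Scope brace_scope.
Local Open Scope group_scope.

(* A copy of B whose [groupType] structure is (B, +): there [x * y] means x + y.
   It is convertible to B, so the type casts below select the group law. *)
Definition additive_group (B : skewBraceType) : Type := B.

HB.instance Definition _ (B : skewBraceType) := Choice.on (additive_group B).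
HB.instance Definition _ (B : skewBraceType) :=
  isGroup.Build (additive_group B) baddA badd0l badd0r baddNl baddNr.

Section SkewBraceDefs.
Variable B : skewBraceType.
Implicit Types (a b : B) (X Y S I : set B).

Definition lam a b : B := - a + a * b.

Definition star a b : B := - a + a * b - b.

Definition star_set X Y : set B :=
  generated ([set star x y | x in X & y in Y] : set (additive_group B)).

Definition is_sub_skew_brace S : Prop :=
  is_subgroup (S : set (additive_group B)) /\ is_subgroup S.

Definition is_ideal I : Prop :=
  [/\ is_normal (I : set (additive_group B)),
      forall b x, I x -> I (lam b x)
    & is_normal I].

Definition Dedekind : Prop := forall S, is_sub_skew_brace S -> is_ideal S.

(* S is meant to be a sub-skew brace; S = B gives the notions for B itself. *)
Definition is_trivial S : Prop :=
  forall a b, S a -> S b -> a + b = a * b.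

Definition is_abelian S : Prop :=
  is_trivial S /\ forall a b, S a -> S b -> a + b = b + a.

(* [iter n _ setT] has n.+1 factors B. *)
Definition left_nilpotent : Prop :=
  exists n : nat, iter n (fun X => star_set setT X) setT = [set 0].

Definition right_nilpotent : Prop :=
  exists n : nat, iter n (fun X => star_set X setT) setT = [set 0].

Definition ker_lam : set B := [set a | forall b, lam a b = b].

Definition center : set B :=
  ker_lam `&` (group_center (additive_group B) : set B) `&` group_center B.

End SkewBraceDefs.

Record ideal (B : skewBraceType) :=
  Ideal { ideal_set :> set B; idealP : is_ideal ideal_set }.

Section SkewBraceTheory.
Variable B : skewBraceType.
Implicit Types a b x y : B.

Local Notation A := (additive_group B : groupType).

Lemma addNKb a b : - a + (a + b) = b.
Proof. exact: (@mulKg A). Qed.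

Lemma addbNK a b : a + (- a + b) = b.
Proof. exact: (@mulVKg A). Qed.

Lemma oppbK : involutive (@bopp B).
Proof. exact: (@invgK A). Qed.

Lemma oppbD a b : - (a + b) = - b - a.
Proof. exact: (@invgM A). Qed.

Lemma mulb0 a : a * 0 = a.
Proof.
have := brace_distr a 0 0; rewrite badd0l -baddA.
move=> /(congr1 (fun z => - (a * 0) + z)); rewrite addNKb baddNl.
by move=> /(congr1 (fun z => a + z)); rewrite addbNK badd0r.
Qed.

Lemma zero_one : 0 = 1 :> B.
Proof. by rewrite -(mul1g 0) mulb0. Qed.

Lemma mul_lam a b : a * b = a + lam a b.
Proof. by rewrite /lam addbNK. Qed.

Lemma lamD a b c : lam a (b + c) = lam a b + lam a c.
Proof. by rewrite /lam brace_distr !baddA. Qed.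

Lemma lam0 a : lam a 0 = 0.
Proof. by rewrite /lam mulb0 baddNl. Qed.

Lemma lam1 b : lam 1 b = b.
Proof. by rewrite /lam mul1g -zero_one -{1}(badd0l (- 0)) baddNr badd0l. Qed.

Lemma lamN a b : lam a (- b) = - lam a b.
Proof.
have : lam a b + lam a (- b) = 0 by rewrite -lamD baddNr lam0.
by move=> /(congr1 (fun z => - lam a b + z)); rewrite addNKb badd0r.
Qed.

Lemma lamM a b c : lam (a * b) c = lam a (lam b c).
Proof.
have -> : lam b c = - b + b * c by [].
rewrite lamD lamN [in RHS]/lam oppbD oppbK -[in RHS]baddA addbNK mulgA.
by [].
Qed.

Lemma lamK a b : lam a^-1 (lam a b) = b.
Proof. by rewrite -lamM mulVg lam1. Qed.

End SkewBraceTheory.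

Section QuotientBrace.
Variables (B : skewBraceType) (I : ideal B).

Local Notation IS := (ideal_set I).

Definition ideal_add : normal_subgroup (additive_group B) :=
  NormalSubgroup (let: And3 nI _ _ := idealP I in nI).

Definition ideal_mul : normal_subgroup B :=
  NormalSubgroup (let: And3 _ _ nI := idealP I in nI).

Let I_lam b x : IS x -> IS (lam b x).
Proof. by case: (idealP I) => _ h _; apply: h. Qed.

(* x + I = x o I: the cosets of I are the same in both groups. *)
Lemma ideal_cosetE : coset_rel ideal_mul =2 coset_rel ideal_add.
Proof.
move=> x y.
have lamE : lam x (x^-1 * y) = - x + y by rewrite /lam mulgA mulgV mul1g.
apply/asboolP/asboolP => /= [/(I_lam x)|].
  by rewrite lamE.
change (IS (- x + y) -> IS (x^-1 * y)).
by rewrite -lamE => /(I_lam x^-1); rewrite lamK.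
Qed.

Definition brace_equiv : equiv_rel B := coset_equiv ideal_add.

Definition quotient_brace : Type := {eq_quot brace_equiv}.

HB.instance Definition _ := Choice.on quotient_brace.
HB.instance Definition _ := EqQuotient.on quotient_brace.

Local Notation proj := (\pi_quotient_brace).

Lemma eq_brace_coset (x y : B) : proj x = proj y <-> IS (- x + y).
Proof. by split=> [/eqmodP /asboolP//|h]; apply/eqmodP/asboolP. Qed.

Definition qadd (X Y : quotient_brace) : quotient_brace :=
  proj (repr X + repr Y).
Definition qzero : quotient_brace := proj 0.
Definition qopp (X : quotient_brace) : quotient_brace := proj (- repr X).
Definition qmul (X Y : quotient_brace) : quotient_brace :=
  proj (repr X * repr Y).
Definition qone : quotient_brace := proj 1.
Definition qinv (X : quotient_brace) : quotient_brace := proj (repr X)^-1.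

Let relK x : coset_rel ideal_add (repr (proj x)) x.
Proof. by apply/(@eqmodP _ brace_equiv); rewrite reprK. Qed.

Let relKm x : coset_rel ideal_mul (repr (proj x)) x.
Proof. by rewrite ideal_cosetE. Qed.

Let proj_eq x y : coset_rel ideal_add y x -> proj x = proj y.
Proof.
by move=> h; apply/(@eqmodP _ brace_equiv); rewrite equiv_sym.
Qed.

Lemma proj_add : {morph proj : x y / x + y >-> qadd x y}.
Proof.
move=> x y; apply: proj_eq.
exact: (@coset_relM _ ideal_add _ _ _ _ (relK x) (relK y)).
Qed.

Lemma proj_opp : {morph proj : x / - x >-> qopp x}.
Proof.
by move=> x; apply: proj_eq; exact: (@coset_relV _ ideal_add _ _ (relK x)).
Qed.

Lemma proj_mul : {morph proj : x y / x * y >-> qmul x y}.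
Proof.
move=> x y; apply: proj_eq; rewrite -ideal_cosetE.
exact: (@coset_relM _ ideal_mul _ _ _ _ (relKm x) (relKm y)).
Qed.

Lemma proj_inv : {morph proj : x / x^-1 >-> qinv x}.
Proof.
move=> x; apply: proj_eq; rewrite -ideal_cosetE.
exact: (@coset_relV _ ideal_mul _ _ (relKm x)).
Qed.

Let qmulA : associative qmul.
Proof.
elim/quotW=> x; elim/quotW=> y; elim/quotW=> z.
by rewrite -(proj_mul y z) -(proj_mul x y) -(proj_mul x) -(proj_mul _ z) mulgA.
Qed.
Let qmul1g : left_id qone qmul.
Proof. by elim/quotW=> x; rewrite -(proj_mul 1 x) mul1g. Qed.
Let qmulg1 : right_id qone qmul.
Proof. by elim/quotW=> x; rewrite -(proj_mul x 1) mulg1. Qed.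
Let qmulVg : left_inverse qone qinv qmul.
Proof. by elim/quotW=> x; rewrite -(proj_inv x) -(proj_mul x^-1 x) mulVg. Qed.
Let qmulgV : right_inverse qone qinv qmul.
Proof. by elim/quotW=> x; rewrite -(proj_inv x) -(proj_mul x x^-1) mulgV. Qed.

HB.instance Definition _ :=
  isGroup.Build quotient_brace qmulA qmul1g qmulg1 qmulVg qmulgV.

Let qaddA : associative qadd.
Proof.
elim/quotW=> x; elim/quotW=> y; elim/quotW=> z.
by rewrite -(proj_add y z) -(proj_add x y) -(proj_add x) -(proj_add _ z) baddA.
Qed.
Let qadd0l : left_id qzero qadd.
Proof. by elim/quotW=> x; rewrite -(proj_add 0 x) badd0l. Qed.
Let qadd0r : right_id qzero qadd.
Proof. by elim/quotW=> x; rewrite -(proj_add x 0) badd0r. Qed.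
Let qaddNl : left_inverse qzero qopp qadd.
Proof. by elim/quotW=> x; rewrite -(proj_opp x) -(proj_add (- x) x) baddNl. Qed.
Let qaddNr : right_inverse qzero qopp qadd.
Proof. by elim/quotW=> x; rewrite -(proj_opp x) -(proj_add x (- x)) baddNr. Qed.
Let q_distr (X Y Z : quotient_brace) :
  X * qadd Y Z = qadd (qadd (X * Y) (qopp X)) (X * Z).
Proof.
elim/quotW: X => x; elim/quotW: Y => y; elim/quotW: Z => z.
change (qmul (proj x) (qadd (proj y) (proj z)) =
  qadd (qadd (qmul (proj x) (proj y)) (qopp (proj x)))
    (qmul (proj x) (proj z))).
rewrite -(proj_add y z) -(proj_mul x (y + z)) -(proj_mul x y) -(proj_mul x z).
rewrite -(proj_opp x) -(proj_add (x * y) (- x)).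
by rewrite -(proj_add _ (x * z)) brace_distr.
Qed.

HB.instance Definition _ :=
  isSkewBrace.Build quotient_brace qaddA qadd0l qadd0r qaddNl qaddNr q_distr.

Definition brace_proj (x : B) : quotient_brace := proj x.

(* The factor J / I, as a subset of B / I. *)
Definition factor (J : set B) : set quotient_brace := brace_proj @` J.

End QuotientBrace.

Arguments brace_proj [B] I x.
Arguments factor [B] I J.

(* A finite series of ideals 0 = I 0 <= ... <= I n = B all of whose factors,
   viewed in [quotient_brace (I i)], satisfy P. *)
Definition ideal_series (B : skewBraceType)
    (P : forall Q : skewBraceType, set Q -> Prop) : Prop :=
  exists (n : nat) (I : nat -> ideal B),
    [/\ (I 0%N : set B) = [set 0],
        (I n : set B) = [set: B]
      & forall i, (i < n)%N ->
        (I i : set B) `<=` I i.+1 /\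
        P (quotient_brace (I i)) (factor (I i) (I i.+1))].

Definition has_trivial_ideal_series (B : skewBraceType) : Prop :=
  ideal_series B is_trivial.

Definition soluble (B : skewBraceType) : Prop :=
  ideal_series B is_abelian.

Lemma zero_is_ideal (B : skewBraceType) : is_ideal [set (0 : B)].
Proof.
split=> [|b x ->|].
- split; last by move=> x g ->; rewrite conj1g.
  by split=> // [x y -> ->|x ->]; [rewrite mulg1 | rewrite invg1].
- exact: lam0.
- rewrite zero_one; split; last by move=> x g ->; rewrite conj1g.
  by split=> // [x y -> ->|x ->]; [rewrite mulg1 | rewrite invg1].
Qed.

Definition zero_ideal (B : skewBraceType) : ideal B := Ideal (zero_is_ideal B).

Lemma centerP (B : skewBraceType) (z : B) :
  center z <->
  [/\ forall b, z * b = z + b, forall b, z + b = b + z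
    & forall b, z * b = b * z].
Proof.
split=> [[[zl za] zm]|[zl za zm]].
  by split=> // b; rewrite mul_lam zl.
split; last by move=> b; apply: zm.
by split=> b; [rewrite /lam zl addNKb | apply: za].
Qed.

Lemma center_oppE (B : skewBraceType) (z : B) : center z -> - z = z^-1.
Proof.
move=> /centerP[zl _ _]; apply: (@mulgI B z).
by rewrite zl baddNr mulgV zero_one.
Qed.

Lemma center_subgroup (B : skewBraceType) :
  is_subgroup (@center B : set (additive_group B)) /\ is_subgroup (@center B).
Proof.
have c1 : center (1 : B).
  by apply/centerP; split=> b; rewrite -?zero_one ?badd0l ?badd0r //
    zero_one mul1g ?mulg1.
have cD (z w : B) : center z -> center w -> center (z + w).
  move=> /centerP[zl za zm] /centerP[wl wa wm]; apply/centerP; split=> b.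
  - by rewrite -{1}zl -mulgA wl zl baddA.
  - by rewrite -[z + w + b]baddA wa baddA za baddA.
  - by rewrite -zl -mulgA wm mulgA (zm b) mulgA.
have cV (z : B) : center z -> center z^-1.
  move=> cz; have Nz := center_oppE cz; move/centerP: cz => [zl za zm].
  apply/centerP; split=> b.
  - apply: (@mulgI B z); rewrite mulVKg -Nz zl.
    by rewrite addbNK.
  - rewrite -Nz; apply: (can_inj (addNKb z)).
    by rewrite addbNK baddA za -baddA baddNr badd0r.
  - apply: (@mulgI B z); rewrite mulVKg mulgA zm.
    by rewrite -mulgA mulgV mulg1.
have c0 : center (0 : B) by rewrite zero_one.
split; split=> //.
- by move=> x cx; rewrite -[x^-1]/(- x) center_oppE //; apply: cV.
- move=> x y cx cy; have /centerP[zl _ _] := cx.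
  by rewrite zl; apply: cD.
Qed.

Lemma center_is_ideal (B : skewBraceType) : is_ideal (@center B).
Proof.
have [cA cM] := center_subgroup B.
split.
- split=> // x g cx; have /centerP[_ za _] := cx.
  by rewrite -[x ^ g]/(- g + (x + g)) za addNKb.
- move=> b x cx; have /centerP[xl xa xm] := cx.
  by rewrite /lam -xm xl xa addNKb.
- split=> // x g cx; have /centerP[_ _ xm] := cx.
  by rewrite conjgE xm mulKg.
Qed.

Definition center_ideal (B : skewBraceType) : ideal B :=
  Ideal (center_is_ideal B).

Section PreimageIdeal.
Variables (B : skewBraceType) (I : ideal B) (J : ideal (quotient_brace I)).

Lemma brace_projD x y : brace_proj I (x + y) = brace_proj I x + brace_proj I y.
Proof. exact: proj_add. Qed.
Lemma brace_projN x : brace_proj I (- x) = - brace_proj I x.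
Proof. exact: proj_opp. Qed.
Lemma brace_projM x y : brace_proj I (x * y) = brace_proj I x * brace_proj I y.
Proof. exact: proj_mul. Qed.
Lemma brace_projV x : brace_proj I x^-1 = (brace_proj I x)^-1.
Proof. exact: proj_inv. Qed.

Lemma preimage_is_ideal : is_ideal (brace_proj I @^-1` J).
Proof.
have [[[a1 aM aV] aJ] Jl [[m1 mM mV] mJ]] := idealP J.
split.
- split; first split.
  + exact: a1.
  + by move=> x y Jx Jy; rewrite /preimage /= brace_projD; apply: aM.
  + by move=> x Jx; rewrite /preimage /= brace_projN; apply: aV.
  + move=> x g Jx; rewrite /preimage /= !conjgE.
    change (ideal_set J (brace_proj I (- g + (x + g)))).
    by rewrite !(brace_projD, brace_projN); apply: aJ.
- move=> b x Jx; rewrite /preimage /= /lam.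
  by rewrite brace_projD brace_projN brace_projM; apply: Jl.
- split; first split.
  + exact: m1.
  + by move=> x y Jx Jy; rewrite /preimage /= brace_projM; apply: mM.
  + by move=> x Jx; rewrite /preimage /= brace_projV; apply: mV.
  + move=> x g Jx; rewrite /preimage /= conjgE !(brace_projM, brace_projV).
    by rewrite -conjgE; apply: mJ.
Qed.

Definition preimage_ideal : ideal B := Ideal preimage_is_ideal.

End PreimageIdeal.

(* Z_0 = 0, and Z_k.+1 is the preimage in B of the centre of B / Z_k. *)
Fixpoint upper_central (B : skewBraceType) (k : nat) : ideal B :=
  if k is k'.+1
  then preimage_ideal (center_ideal (quotient_brace (upper_central B k')))
  else zero_ideal B.

Definition centrally_nilpotent (B : skewBraceType) : Prop :=
  exists n : nat, (upper_central B n : set B) = [set: B].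

(* Main.v *)
Require Import Defs.
From mathcomp Require Import all_boot.
From mathcomp Require Import zify ring.
From mathcomp Require Import boolp classical_sets cardinality.

(** Write <c> for the sub-skew brace generated by c. In a Dedekind skew brace
    it is an ideal, it is the cyclic group of the multiples of c as soon as
    c * c = 0 (star product), and the commutators of x with c, for the
    lambda-action and for both group laws, lie in the intersection of <x> and
    <c>.

    Solubility. If J / I is a trivial factor, all its subgroups are ideals of
    B / I, so J / I is a Dedekind group. Conjugations act on each of its cyclic
    subgroups as power maps, which commute; so commutators are central, and
    the centre of J / I refines the factor into two abelian ones. If B is left
    or right nilpotent, the terms of the corresponding series are sub-skew
    braces, hence ideals, with trivial factors.

    Central nilpotency. A series with trivial factors forces the sequence c,
    c * c, (c * c) * (c * c), and so on to reach 0 in a bounded number of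
    steps, so <c> has a finite series of ideals with cyclic factors. The heart
    of the proof is [prime_order_center]: if x * x = 0 and p x = 0 with p prime,
    then x is central. By Zorn's lemma one may assume that every nonzero <c>
    contains x. Then all elements turn out to have p-power order in (B, o); as
    they act on the cyclic group <x> of order p through groups of order p - 1,
    they act trivially. The p-power orders are obtained by induction along <c>;
    the inductive step is [cent_mod_prime], which finds, for c with c * c in
    <x>, an element acting on <x> as c does and generating a trivial brace.

    Consequently an element a of infinite order with a * a = 0 is central,
    since it is so modulo q a for every prime q. A calculation in
    [star_self_torsion] then shows that c * c always generates a finite ideal.
    So the elements of finite order form an ideal T, and every element of B is
    central modulo T ([torsion_quotient_central]).

    It remains to put T inside a term of the upper central series. Its
    intersections with a soluble series have abelian periodic factors, in
    which only the finitely many primes of (B, +) or (B, o) occur. In such a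
    factor the elements of order dividing p ^ i lie in the i-th centre. This
    settles a p-component of bounded exponent. If the p-component is
    unbounded, then it is central: B acts on it by power maps, whose
    commutators with a given c lie in <c> and thus have bounded order, and on
    an unbounded abelian p-group only the identity is such a power map
    ([power_map_trivial]). *)

Set Implicit Arguments.
Unset Strict Implicit.
Unset Printing Implicit Defensive.

Local Open Scope classical_set_scope.
Local Open Scope brace_scope.
Local Open Scope group_scope.

(** * Arithmetic in skew braces, sub-skew braces and ideals *)

Section Basics.
Variable B : skewBraceType.
Implicit Types (a b c x y : B) (S : set B).

Definition nmul (x : B) (n : nat) : B := (x : additive_group B) ^+ n.
Local Notation "x *+ n" := (nmul x n) : brace_scope.

Lemma baddK a b : a + b - b = a. Proof. exact: (@mulgK (additive_group B)). Qed.
Lemma baddI a b c : a + b = a + c -> b = c.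
Proof. exact: (@mulgI (additive_group B)). Qed.
Lemma baddIr a b c : b + a = c + a -> b = c.
Proof. exact: (@mulIg (additive_group B)). Qed.
Lemma oppb0 : - 0 = 0 :> B. Proof. exact: (@invg1 (additive_group B)). Qed.

Definition addE :=
  (oppbD, @oppbK B, oppb0, addNKb, addbNK, @baddNl B, @baddNr B,
   @badd0l B, @badd0r B).

Lemma addb_eq0 a b : a - b = 0 -> a = b.
Proof. by move=> h; apply: (@baddIr (- b)); rewrite h !addE. Qed.

Lemma nmul0 x : x *+ 0 = 0. Proof. by []. Qed.
Lemma nmul1 x : x *+ 1 = x. Proof. by []. Qed.
Lemma nmulS x n : x *+ n.+1 = x + x *+ n.
Proof. exact: (@expgS (additive_group B)). Qed.
Lemma nmulSr x n : x *+ n.+1 = x *+ n + x.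
Proof. exact: (@expgSr (additive_group B)). Qed.
Lemma nmulD x m n : x *+ (m + n) = x *+ m + x *+ n.
Proof. exact: (@expgnDr (additive_group B)). Qed.
Lemma nmulA x m n : x *+ (m * n) = x *+ m *+ n.
Proof. exact: (@expgnA (additive_group B)). Qed.
Lemma nmulAC x m n : x *+ m *+ n = x *+ n *+ m.
Proof. exact: (@expgnAC (additive_group B)). Qed.
Lemma nmul0b n : 0 *+ n = 0. Proof. exact: (@expg1n (additive_group B)). Qed.

Lemma lam_nmul a b n : lam a (b *+ n) = lam a b *+ n.
Proof. by elim: n => [|n IH]; rewrite ?lam0 // !nmulS lamD IH. Qed.

Lemma lamV a b : lam a (lam a^-1 b) = b.
Proof. by rewrite -lamM mulgV lam1. Qed.

Lemma lam_inj a : injective (lam a).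
Proof. exact: can_inj (@lamK B a). Qed.

Lemma starE a b : star a b = lam a b - b. Proof. by []. Qed.

Lemma star_eq0 a b : (star a b = 0) <-> (lam a b = b).
Proof.
rewrite starE; split=> [|->]; last exact: baddNr.
exact: addb_eq0.
Qed.

Lemma sub_braceP S :
  S 0 -> (forall x y, S x -> S y -> S (x + y)) -> (forall x, S x -> S (- x)) ->
  (forall x y, S x -> S y -> S (x * y)) -> (forall x, S x -> S x^-1) ->
  is_sub_skew_brace S.
Proof. by move=> h0 hD hN hM hV; split; split=> //; rewrite -zero_one. Qed.

Section SubBraceTheory.
Variables (S : set B) (hS : is_sub_skew_brace S).
Lemma sbr0 : S 0. Proof. by case: hS => [[]]. Qed.
Lemma sbr1 : S 1. Proof. by case: hS => _ []. Qed.
Lemma sbrD x y : S x -> S y -> S (x + y).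
Proof. by case: hS => [[_ h _] _]; apply: h. Qed.
Lemma sbrN x : S x -> S (- x).
Proof. by case: hS => [[_ _ h] _]; apply: h. Qed.
Lemma sbrM x y : S x -> S y -> S (x * y).
Proof. by case: hS => [_ [_ h _]]; apply: h. Qed.
Lemma sbrV x : S x -> S x^-1.
Proof. by case: hS => [_ [_ _ h]]; apply: h. Qed.
Lemma sbrX x n : S x -> S (x ^+ n).
Proof.
move=> hx; elim: n => [|n IH]; first exact: sbr1.
by rewrite expgS; apply: sbrM.
Qed.
Lemma sbrMn x n : S x -> S (x *+ n).
Proof.
move=> hx; elim: n => [|n IH]; first exact: sbr0.
by rewrite nmulS; apply: sbrD.
Qed.
Lemma sbr_lam x y : S x -> S y -> S (lam x y).
Proof. by move=> hx hy; apply: sbrD; [exact: sbrN | exact: sbrM]. Qed.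
Lemma sbr_star x y : S x -> S y -> S (star x y).
Proof. by move=> hx hy; apply: sbrD; [exact: sbr_lam | exact: sbrN]. Qed.
End SubBraceTheory.

Definition gen (c : B) : set B := smallest (@is_sub_skew_brace B) [set c].

Lemma gen_sub c : is_sub_skew_brace (gen c).
Proof.
apply: sub_braceP => [|x y hx hy|x hx|x y hx hy|x hx] S [hS cS].
- exact: sbr0.
- by apply: (sbrD hS); [apply: hx | apply: hy].
- by apply: (sbrN hS); apply: hx.
- by apply: (sbrM hS); [apply: hx | apply: hy].
- by apply: (sbrV hS); apply: hx.
Qed.

Lemma mem_gen c : gen c c. Proof. by move=> S [_]; apply. Qed.

Lemma gen_min c S : is_sub_skew_brace S -> S c -> gen c `<=` S.
Proof. by move=> hS Sc y; apply; split=> // _ ->. Qed.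

End Basics.

Arguments gen {B} c.
Arguments mem_gen {B} c _ _ : rename.
Notation "x *+ n" := (nmul x n) : brace_scope.

Section IdealTheory.
Variables (B : skewBraceType) (I : ideal B).
Implicit Types (b c g x y : B) (S : set B).
Local Notation IS := (ideal_set I).
Lemma ideal_sub : is_sub_skew_brace IS.
Proof. by case: (idealP I) => [[h _] _ [h' _]]. Qed.
Lemma ideal_conj g x : IS x -> IS (- g + (x + g)).
Proof. by case: (idealP I) => [[_ h] _ _]; apply: h. Qed.
Lemma ideal_conjN g x : IS x -> IS (g + (x - g)).
Proof. by move=> /(ideal_conj (- g)); rewrite oppbK. Qed.
Lemma ideal_lam b x : IS x -> IS (lam b x).
Proof. by case: (idealP I) => [_ h _]; apply: h. Qed.
Lemma ideal_conjg g x : IS x -> IS (x ^ g).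
Proof. by case: (idealP I) => [_ _ [_ h]]; apply: h. Qed.

Lemma ideal_starr b x : IS x -> IS (star b x).
Proof.
move=> hx; apply: (sbrD ideal_sub); first exact: ideal_lam.
exact: (sbrN ideal_sub).
Qed.
(** This rests on the identity x o b = b o x^b = b + lam_b (x^b). *)
Lemma ideal_starl b x : IS x -> IS (star x b).
Proof.
move=> hx.
have -> : star x b = - x + (b + (lam b (x ^ b) - b)).
  by rewrite /star conjgC mul_lam -!baddA.
apply: (sbrD ideal_sub); first exact: (sbrN ideal_sub).
by apply: ideal_conjN; apply: ideal_lam; apply: ideal_conjg.
Qed.

Local Notation pi := (brace_proj I).

Lemma projP (X : quotient_brace I) : exists x, X = pi x.
Proof. by exists (repr X); rewrite /brace_proj reprK. Qed.
Lemma proj_eqP x y : pi x = pi y <-> IS (- x + y).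
Proof. exact: eq_brace_coset. Qed.
Lemma proj0 : pi 0 = 0. Proof. by []. Qed.
Lemma proj_eq0 x : pi x = 0 <-> IS x.
Proof.
rewrite -proj0; split=> [/esym|] h; first by move/proj_eqP: h; rewrite !addE.
by apply/esym/proj_eqP; rewrite !addE.
Qed.
Lemma projX x n : pi (x ^+ n) = pi x ^+ n.
Proof. by elim: n => // n IH; rewrite !expgS brace_projM IH. Qed.
Lemma proj_lam x y : pi (lam x y) = lam (pi x) (pi y).
Proof. by rewrite /lam brace_projD brace_projN brace_projM. Qed.
Lemma proj_star x y : pi (star x y) = star (pi x) (pi y).
Proof. by rewrite !starE brace_projD brace_projN proj_lam. Qed.

Lemma preim_sub (S : set (quotient_brace I)) :
  is_sub_skew_brace S -> is_sub_skew_brace (pi @^-1` S).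
Proof.
move=> hS; apply: sub_braceP => [|x y Sx Sy|x Sx|x y Sx Sy|x Sx].
- exact: (sbr0 hS).
- by change (S (pi (x + y))); rewrite brace_projD; apply: sbrD.
- by change (S (pi (- x))); rewrite brace_projN; apply: sbrN.
- by change (S (pi (x * y))); rewrite brace_projM; apply: sbrM.
- by change (S (pi x^-1)); rewrite brace_projV; apply: sbrV.
Qed.

Lemma im_sub S : is_sub_skew_brace S -> is_sub_skew_brace (pi @` S).
Proof.
move=> hS; apply: sub_braceP.
- by exists 0 => //; apply: sbr0.
- move=> _ _ [x hx <-] [y hy <-].
  by exists (x + y); [apply: sbrD|rewrite brace_projD].
- by move=> _ [x hx <-]; exists (- x); [apply: sbrN|rewrite brace_projN].
- move=> _ _ [x hx <-] [y hy <-].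
  by exists (x * y); [apply: sbrM|rewrite brace_projM].
- by move=> _ [x hx <-]; exists x^-1; [apply: sbrV|rewrite brace_projV].
Qed.

Lemma proj_gen c y : gen c y -> gen (pi c) (pi y).
Proof.
apply: (@gen_min _ _ (pi @^-1` gen (pi c))); last exact: mem_gen.
exact: preim_sub (gen_sub _).
Qed.

End IdealTheory.

Lemma gen_proj (B : skewBraceType) (I : ideal B) c Y : gen (brace_proj I c) Y ->
  exists2 y, gen c y & brace_proj I y = Y.
Proof.
move=> h; apply: (@gen_min _ _ (brace_proj I @` gen c)) h.
  exact: im_sub (gen_sub _).
by exists c => //; apply: mem_gen.
Qed.

Lemma proj_nmul (B : skewBraceType) (I : ideal B) x n :
  brace_proj I (x *+ n) = brace_proj I x *+ n.
Proof. by elim: n => // n IH; rewrite !nmulS brace_projD IH. Qed.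

Definition ded_ideal (B : skewBraceType) (hB : Dedekind B) S
  (hS : is_sub_skew_brace S) : ideal B := Ideal (hB _ hS).

Definition gen_ideal (B : skewBraceType) (hB : Dedekind B) (c : B) : ideal B :=
  ded_ideal hB (gen_sub c).

Lemma Dedekind_quotient (B : skewBraceType) (I : ideal B) :
  Dedekind B -> Dedekind (quotient_brace I).
Proof.
move=> hB S hS; pose J := ded_ideal hB (preim_sub hS).
have SJ x : S (brace_proj I x) = ideal_set J x by [].
split.
- split; first by case: (hS).
  move=> X G; have [x ->] := projP X; have [g ->] := projP G => Sx.
  have := @ideal_conj _ J g x Sx.
  by rewrite -SJ !brace_projD brace_projN.
- move=> b X; have [x ->] := projP X; have [g ->] := projP b => Sx.
  by rewrite -proj_lam SJ; apply: ideal_lam.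
- split; first by case: (hS).
  move=> X G; have [x ->] := projP X; have [g ->] := projP G => Sx.
  change (S ((brace_proj I g)^-1 * (brace_proj I x * brace_proj I g))).
  by rewrite -brace_projV -!brace_projM SJ -conjgE; apply: ideal_conjg.
Qed.

(** * Elements with c * c = 0 and cyclic sub-skew braces *)

Lemma zpow_subgroup (G : groupType) (c : G) :
  is_subgroup [set y | exists m n, y = c ^+ m * c ^- n].
Proof.
have comm m n : commute (c ^- m) (c ^+ n).
  by apply/commute_sym/commuteV/commuteX2.
split.
- by exists 0%N, 0%N; rewrite expg0 invg1 mulg1.
- move=> _ _ [m [n ->]] [m' [n' ->]]; exists (m + m')%N, (n' + n)%N.
  by rewrite !expgnDr invgM !mulgA -[_ * c ^- n * _]mulgA comm !mulgA.
- by move=> _ [m [n ->]]; exists n, m; rewrite invgM invgK.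
Qed.

Section CyclicBrace.
Variables (B : skewBraceType) (c : B).
Hypothesis cc0 : star c c = 0.

Lemma star0_lam : lam c c = c. Proof. exact/star_eq0. Qed.

Lemma star0_expg n : c ^+ n = c *+ n.
Proof.
elim: n => [|n IH]; first by rewrite nmul0 zero_one.
by rewrite expgS IH mul_lam lam_nmul star0_lam nmulS.
Qed.

Lemma star0_lamX m n : lam (c ^+ m) (c *+ n) = c *+ n.
Proof.
elim: m => [|m IH]; first by rewrite lam1.
by rewrite expgSr lamM lam_nmul star0_lam IH.
Qed.

Lemma star0_expgV n : c ^- n = - (c *+ n).
Proof.
apply: (@mulgI B (c ^+ n)); rewrite mulgV mul_lam lamN star0_lamX star0_expg.
by rewrite baddNr zero_one.
Qed.

Lemma nmul_sgn m n : exists k,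
  c *+ m - c *+ n = c *+ k \/ c *+ m - c *+ n = - (c *+ k).
Proof.
have [le|/ltnW le] := leqP n m.
  by exists (m - n)%N; left; rewrite -{1}(subnK le) nmulD baddK.
by exists (n - m)%N; right; rewrite -{1}(subnK le) nmulD !addE.
Qed.

(** When lam_c fixes c, the two cyclic groups generated by c in (B, +) and in
    (B, o) consist of the same elements, so this set is already closed under
    all operations. *)
Lemma gen_star0 y : gen c y -> exists n, y = c *+ n \/ y = - (c *+ n).
Proof.
have mulE m n : c ^+ m * c ^- n = c *+ m - c *+ n.
  by rewrite mul_lam star0_expgV lamN star0_lamX star0_expg.
pose Z := [set y | exists m n, y = c *+ m - c *+ n].
have ZE : Z = [set y | exists m n, y = c ^+ m * c ^- n].
  by apply/seteqP; split=> _ [m [n ->]]; exists m, n; rewrite mulE.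
have hZ : is_sub_skew_brace Z.
  split; last by rewrite ZE; apply: zpow_subgroup.
  exact: (@zpow_subgroup (additive_group B) c).
suff: gen c `<=` Z by move=> /[apply] -[m [n ->]]; apply: nmul_sgn.
by apply: gen_min => //; exists 1%N, 0%N; rewrite nmul1 nmul0 !addE.
Qed.

End CyclicBrace.

Section Central.
Variable B : skewBraceType.
Implicit Types c e x y : B.

(** Centrality of x, tested against c alone. *)
Definition cent x c := [/\ lam c x = x, x + c = c + x & x * c = c * x].

Lemma cent0 c : cent 0 c.
Proof. by split; rewrite ?lam0 ?addE // zero_one mul1g mulg1. Qed.

Lemma centerE x : (forall c, cent x c) <-> center x.
Proof.
rewrite centerP; split=> [h|[zl za zm] c].
  split=> c; have [h1 h2 h3] := h c => //.
  by rewrite h3 mul_lam h1 h2.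
by split=> //; rewrite /lam -zm zl za addNKb.
Qed.

Definition commutators x c : set B :=
  [set star c x; x + c - (c + x); x^-1 * x ^ c].

Lemma centP x c : cent x c <-> commutators x c `<=` [set 0].
Proof.
split=> [[h1 h2 h3] _ [[|]|] ->|h]; rewrite /= ?starE.
- by rewrite h1 baddNr.
- by rewrite h2 baddNr.
- by rewrite conjgE h3 mulKg mulVg zero_one.
split; [apply/star_eq0|apply: addb_eq0|].
- by apply: h; left; left.
- by apply: h; left; right.
have xc : x^-1 * x ^ c = 0 by apply: h; right.
by rewrite conjgC -[x ^ c](mulVKg x) mulgA xc zero_one mulg1.
Qed.

Lemma gen_cent e y : star e e = 0 -> gen e y -> cent y e.
Proof.
move=> ee0 /(gen_star0 ee0)[n yE].
have lamn : lam e (e *+ n) = e *+ n by rewrite lam_nmul star0_lam.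
have cA : commute (e : additive_group B) ((e : additive_group B) ^+ n).
  exact/commuteX.
have cM : commute e (e ^+ n) by exact/commuteX.
case: yE => ->; split; rewrite ?lamN ?lamn //.
- by symmetry; rewrite -star0_expg //; exact: cM.
- by symmetry; exact: (commuteV cA).
- by symmetry; rewrite -star0_expgV //; exact: (commuteV cM).
Qed.

Lemma nmul_mod x p m n : x *+ p = 0 -> m = n %[mod p] -> x *+ m = x *+ n.
Proof.
move=> px mn; rewrite (divn_eq m p) (divn_eq n p) mn !nmulD.
by rewrite ![(_ * p)%N]mulnC !nmulA px !nmul0b.
Qed.

Lemma prime_gen x y p : prime p -> x *+ p = 0 -> gen x y -> star x x = 0 ->
  exists n, y = x *+ n.
Proof.
move=> pp px /gen_star0 h /h[n [|] ->]; first by exists n.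
exists (p.-1 * n)%N; apply: (@baddI _ (x *+ n)); rewrite baddNr -nmulD.
by rewrite -mulSn prednK ?prime_gt0 // nmulA px nmul0b.
Qed.

Lemma prime_dvd x p n :
  prime p -> x *+ p = 0 -> x <> 0 -> x *+ n = 0 -> (p %| n)%N.
Proof.
move=> pp px x0 nx; apply/negPn/negP => pn; apply: x0.
have: coprime n p by rewrite coprime_sym prime_coprime.
have n0 : (0 < n)%N by case: n pn {nx} => //; rewrite dvdn0.
case/(coprimeP _ n0) => -[a b] /= h.
have hb : (a * n = 1 + b * p)%N by lia.
have : x *+ (a * n) = x by rewrite hb nmulD mulnC nmulA px nmul0b nmul1 !addE.
by rewrite mulnC nmulA nx nmul0b.
Qed.

Lemma prime_inj x p m n : prime p -> x *+ p = 0 -> x <> 0 -> x *+ m = x *+ n ->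
  m = n %[mod p].
Proof.
move=> pp px x0; wlog le: m n / (n <= m)%N.
  by move=> h; case/orP: (leq_total n m) => le e; [|apply/esym]; apply: h.
move=> e; apply/eqP; rewrite eqn_mod_dvd //; apply: (prime_dvd pp px x0).
by apply: (@baddIr _ (x *+ n)); rewrite -nmulD subnK // e !addE.
Qed.

Lemma prime_gen_sym x y p : prime p -> x *+ p = 0 -> star x x = 0 ->
  gen x y -> y <> 0 -> exists k, x = y *+ k.
Proof.
move=> pp px xx0 /(prime_gen pp px)/(_ xx0)[n ->] nx0.
have pn : ~~ (p %| n)%N.
  apply/negP=> /dvdnP[k nE]; apply: nx0.
  by rewrite nE mulnC nmulA px nmul0b.
have n0 : (0 < n)%N by case: n pn {nx0} => //; rewrite dvdn0.
have: coprime n p by rewrite coprime_sym prime_coprime.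
case/(coprimeP _ n0) => -[a b] /= h; exists a.
have hb : (n * a = 1 + b * p)%N by lia.
by rewrite -nmulA hb nmulD mulnC nmulA px nmul0b nmul1 !addE.
Qed.

End Central.

Section QuotientCentral.
Variables (B : skewBraceType) (I : ideal B).
Implicit Types c x y : B.
Local Notation pi := (brace_proj I).

Lemma proj_commutators x c y :
  commutators x c y -> commutators (pi x) (pi c) (pi y).
Proof.
move=> [[|]|] ->; [left; left|left; right|right].
- exact: proj_star.
- by rewrite !(brace_projD, brace_projN).
- by rewrite conjgE !(brace_projM, brace_projV) -conjgE.
Qed.

Lemma proj_cent x c : cent (pi x) (pi c) <-> commutators x c `<=` ideal_set I.
Proof.
rewrite centP; split=> h.
  by move=> y /proj_commutators/h/proj_eq0.
move=> _ [[|]|] ->.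
- by rewrite -proj_star; apply/proj_eq0/h; left; left.
- have <- : pi (x + c - (c + x)) = pi x + pi c - (pi c + pi x).
    by rewrite !(brace_projD, brace_projN).
  by apply/proj_eq0/h; left; right.
- have <- : pi (x^-1 * x ^ c) = (pi x)^-1 * pi x ^ pi c.
    by rewrite conjgE !(brace_projM, brace_projV) -conjgE.
  by apply/proj_eq0/h; right.
Qed.

Lemma center_projP x :
  center (pi x) <-> forall c, commutators x c `<=` ideal_set I.
Proof.
rewrite -centerE; split=> h c; first exact/proj_cent.
by have [{}c ->] := projP c; apply/proj_cent.
Qed.

End QuotientCentral.

Section GenIdeal.
Variables (B : skewBraceType) (hB : Dedekind B).
Implicit Types a b c e x y : B.

Lemma gen_conj a x g : gen a x -> gen a (- g + (x + g)).
Proof. exact: (@ideal_conj _ (gen_ideal hB a)). Qed.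
Lemma gen_conjN a x g : gen a x -> gen a (g + (x - g)).
Proof. exact: (@ideal_conjN _ (gen_ideal hB a)). Qed.
Lemma gen_lam a x b : gen a x -> gen a (lam b x).
Proof. exact: (@ideal_lam _ (gen_ideal hB a)). Qed.
Lemma gen_conjg a x g : gen a x -> gen a (x ^ g).
Proof. exact: (@ideal_conjg _ (gen_ideal hB a)). Qed.
Lemma gen_starl a x b : gen a x -> gen a (star x b).
Proof. exact: (@ideal_starl _ (gen_ideal hB a)). Qed.
Lemma gen_starr a x b : gen a x -> gen a (star b x).
Proof. exact: (@ideal_starr _ (gen_ideal hB a)). Qed.

(** In the ideal <x>, and symmetrically in <c>, each commutator is a
    difference of an element of the ideal and one of its images. *)
Lemma commutators_genl x c : commutators x c `<=` gen x.
Proof.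
move=> _ [[|]|] ->.
- by apply: gen_starr; apply: mem_gen.
- rewrite !addE -!baddA; apply: (sbrD (gen_sub x)); first exact: mem_gen.
  by apply: gen_conjN; apply: (sbrN (gen_sub x)); apply: mem_gen.
- apply: (sbrM (gen_sub x)); last by apply: gen_conjg; apply: mem_gen.
  by apply: (sbrV (gen_sub x)); apply: mem_gen.
Qed.

Lemma commutators_genr x c : commutators x c `<=` gen c.
Proof.
move=> _ [[|]|] ->.
- by apply: gen_starl; apply: mem_gen.
- rewrite !addE -!baddA [c + _]baddA baddA; apply: (sbrD (gen_sub c)).
    by apply: gen_conjN; apply: mem_gen.
  by apply: (sbrN (gen_sub c)); apply: mem_gen.
- have -> : x^-1 * x ^ c = c^-1 ^ x * c by rewrite !conjgE !mulgA.
  apply: (sbrM (gen_sub c)); last exact: mem_gen.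
  by apply: gen_conjg; apply: (sbrV (gen_sub c)); apply: mem_gen.
Qed.

(** The ideals <x>, of prime order, and <e> either meet in 0, where the
    commutators of x with e then lie, or <e> contains x and is commutative. *)
Lemma star0_cent p x e :
  prime p -> x *+ p = 0 -> star x x = 0 -> star e e = 0 -> cent x e.
Proof.
move=> pp px xx0 ee0.
have [ex|nex] := pselect (gen e x); first exact: gen_cent.
apply/centP => y xey; apply: contrapT => y0; apply: nex.
have gxy := commutators_genl xey; have gey := commutators_genr xey.
have [k ->] := prime_gen_sym pp px xx0 gxy y0.
by apply: (sbrMn (gen_sub e)).
Qed.

End GenIdeal.

(** * Centrality of elements of prime order *)

Section PrimeAction.
Variables (B : skewBraceType) (hB : Dedekind B) (x : B) (p : nat).
Hypotheses (pp : prime p) (px : x *+ p = 0) (xx0 : star x x = 0).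
Implicit Types c : B.

Lemma prime_act c : exists u v w,
  [/\ lam c x = x *+ u, - c + (x + c) = x *+ v & x ^ c = x *+ w].
Proof.
have genE y : gen x y -> exists n, y = x *+ n.
  by move=> h; exact: (prime_gen pp px h xx0).
have [u ->] := genE _ (gen_lam hB c (mem_gen x)).
have [v ->] := genE _ (gen_conj hB c (mem_gen x)).
have [w ->] := genE _ (gen_conjg hB c (mem_gen x)).
by exists u, v, w.
Qed.

Lemma lam_expg c u n : lam c x = x *+ u -> lam (c ^+ n) x = x *+ (u ^ n).
Proof.
move=> cu; elim: n => [|n IH]; first by rewrite lam1.
by rewrite expgS lamM IH lam_nmul cu -nmulA expnS.
Qed.

Lemma conj_nmul c y v n : - c + (y + c) = v -> - c + (y *+ n + c) = v *+ n.
Proof.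
move=> <-; elim: n => [|n IH]; first by rewrite !nmul0 !addE.
by rewrite !nmulS -IH -!baddA !addE.
Qed.

(** Additive conjugation by c acts on <x> as a homomorphism from (B, o), not
    only from (B, +): conjugating by lam_c y amounts to conjugating by y,
    because the power map lam_c of <x> commutes with every other. *)
Lemma conj_expg c v n : - c + (x + c) = x *+ v ->
  - (c ^+ n) + (x + c ^+ n) = x *+ (v ^ n).
Proof.
move=> cv; elim: n => [|n IH]; first by rewrite expg0 -zero_one !addE.
have [k kE] : exists k, lam c (x *+ k) = x.
  have [k kE] := prime_gen pp px (gen_lam hB c^-1 (mem_gen x)) xx0.
  by exists k; rewrite -kE lamV.
have step y w : - y + (x + y) = x *+ w ->
    - lam c y + (x + lam c y) = x *+ w.
  move=> yw; rewrite -{1}kE -lamD -lamN -lamD (conj_nmul _ yw).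
  by rewrite nmulAC lam_nmul kE.
have conjD a b : - (a + b) + (x + (a + b)) = - b + ((- a + (x + a)) + b).
  by rewrite !addE -!baddA.
rewrite expgS mul_lam conjD cv (conj_nmul _ (step _ _ IH)).
by rewrite -nmulA mulnC expnS.
Qed.

Lemma expg_conj c w n : x ^ c = x *+ w -> x ^ (c ^+ n) = x *+ (w ^ n).
Proof.
move=> cw; elim: n => [|n IH]; first by rewrite conjg1.
rewrite expgSr conjgM IH -!(star0_expg xx0) conjXg cw -(star0_expg xx0).
by rewrite -expgnA expnS.
Qed.

Lemma cent_act c : cent x c <->
  [/\ lam c x = x, - c + (x + c) = x & x ^ c = x].
Proof.
split=> -[h1 h2 h3]; split=> //.
- by rewrite h2 !addE.
- by rewrite conjgE h3 mulKg.
- by rewrite -{2}h2 !addE.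
- by rewrite conjgC h3.
Qed.

Lemma fermat_exp (a N : nat) : a ^ (p ^ N) = a %[mod p].
Proof.
elim: N => [|N IH]; first by rewrite expn1.
by rewrite expnSr expnM fermat_little.
Qed.

(** By Fermat's little theorem, raising c to a power of p does not change its
    three actions on a group of order p. *)
Lemma cent_exp_p c N : cent x (c ^+ (p ^ N)) -> cent x c.
Proof.
have [u [v [w [cu cv cw]]]] := prime_act c.
move/cent_act; rewrite (lam_expg _ cu) (conj_expg _ cv) (expg_conj _ cw).
have F a : x *+ (a ^ (p ^ N)) = x *+ a.
  by apply: (nmul_mod px); apply: fermat_exp.
by rewrite !F => -[h1 h2 h3]; apply/cent_act; rewrite cu cv cw.
Qed.

End PrimeAction.

Section FixedPower.
Variables (B : skewBraceType).
Implicit Types (c d y : B).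

(** The lambda-map of the opposite skew brace, where a + b is replaced with
    b + a. *)
Definition rlam a b : B := a * b - a.

Lemma rlamE a b : rlam a b = a + (lam a b - a).
Proof. by rewrite /rlam mul_lam baddA. Qed.

Lemma rlamD a y z : rlam a (y + z) = rlam a y + rlam a z.
Proof. by rewrite !rlamE lamD -!baddA addNKb. Qed.

Lemma rlamM a b y : rlam (a * b) y = rlam a (rlam b y).
Proof.
rewrite [rlam b y]/rlam rlamD /rlam mulgA -!baddA; congr (_ + _).
by rewrite (mul_lam a (- b)) lamN /lam !addE -!baddA !addE.
Qed.

(** Here [mu] stands for [lam] or [rlam]. As mu_c fixes x and moves c by a
    multiple of x, its p-th iterate moves c by p times this multiple, that is
    by 0, and then fixes all powers of c. *)
Lemma expg_fixed (mu : B -> B -> B) (p j : nat) (c x : B) :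
  (forall a y z, mu a (y + z) = mu a y + mu a z) ->
  (forall a b y, mu (a * b) y = mu a (mu b y)) ->
  (forall y, mu 1 y = y) ->
  (forall a y, a * y = a + mu a y) \/ (forall a y, a * y = mu a y + a) ->
  mu c x = x -> mu c c = c + x *+ j -> x *+ p = 0 ->
  forall n, mu (c ^+ p) (c ^+ n) = c ^+ n.
Proof.
move=> muD muM mu1 mulE cx cc px.
have mu0 a : mu a 0 = 0.
  by apply: (@baddI _ (mu a 0)); rewrite -muD !addE.
have muX a y n : mu a (y *+ n) = mu a y *+ n.
  by elim: n => // n IH; rewrite !nmulS muD IH.
have mucn n : mu (c ^+ n) c = c + x *+ (j * n).
  elim: n => [|n IH]; first by rewrite mu1 muln0 nmul0 !addE.
  by rewrite expgS muM IH muD cc muX cx mulnS nmulD baddA.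
have dc : mu (c ^+ p) c = c by rewrite mucn mulnC nmulA px nmul0b !addE.
elim=> [|n IH]; first by rewrite expg0 -zero_one mu0.
have dcn : mu (c ^+ p) (mu c (c ^+ n)) = mu c (c ^+ n).
  by rewrite -muM -expgSr expgS muM IH.
by rewrite expgS; case: mulE => ->; rewrite muD dc dcn.
Qed.

Lemma lam_expg_star0 (p j : nat) (c x : B) :
  lam c x = x -> lam c c = c + x *+ j -> x *+ p = 0 ->
  star (c ^+ p) (c ^+ p) = 0.
Proof.
move=> cx cc px; apply/star_eq0.
apply: (expg_fixed (@lamD B) (@lamM B) (@lam1 B) _ cx cc px).
by left=> a y; apply: mul_lam.
Qed.

Lemma rlam_expg_star0 (p j : nat) (c x : B) :
  rlam c x = x -> rlam c c = c + x *+ j -> x *+ p = 0 ->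
  star (c ^+ p) (c ^+ p) = 0.
Proof.
move=> cx cc px; have rlam1 y : rlam 1 y = y.
  by rewrite /rlam mul1g -zero_one !addE.
have := expg_fixed rlamD rlamM rlam1 _ cx cc px p; rewrite /star /rlam.
move=> /(_ _)/wrap[|h]; first by right=> a y; rewrite -baddA !addE.
by rewrite -baddA h !addE.
Qed.

End FixedPower.

Section Base.
Variables (B : skewBraceType) (hB : Dedekind B) (x : B) (p : nat).
Hypotheses (pp : prime p) (px : x *+ p = 0) (xx0 : star x x = 0).

Lemma mod_solve (a j : nat) :
  ~~ (p %| a)%N -> exists k, (a * k + j = 0 %[mod p])%N.
Proof.
move=> pa; have a0 : (0 < a)%N by case: a pa => //; rewrite dvdn0.
have: coprime a p by rewrite coprime_sym prime_coprime.
case/(coprimeP _ a0) => -[b c] /= h; exists (b * (p.-1 * j))%N.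
have -> : (a * (b * (p.-1 * j)) + j = (c * p.-1 * j + j) * p)%N.
  have p0 := prime_gt0 pp; have : p = p.-1.+1 by rewrite prednK.
  have -> : (a * (b * (p.-1 * j)) = (c * p + 1) * (p.-1 * j))%N.
    have -> : (c * p + 1 = b * a)%N by lia.
    by rewrite mulnA [(a * b)%N]mulnC.
  by move=> {2 4}->; nia.
by rewrite modnMl mod0n.
Qed.

(** Let c act on <x> by lam_c x = u x, by - c + x + c = v x, and let
    lam_x c = c + f x. Computing x o c o c in two ways gives
    f (v + f - 1) = 0 modulo p. If f + u <> 1, some translate e of c by a
    multiple of x satisfies e * e = 0. Otherwise u = 1 or u = v, which means
    that lam_c or rlam_c fixes x, and the p-th power e of c satisfies
    e * e = 0. In both cases e acts on <x> as c does, and [star0_cent]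
    applies to e. *)
Lemma cent_mod_prime c : gen x (star c c) -> cent x c.
Proof.
move=> gcc.
have [x0|x0] := pselect (x = 0); first by rewrite x0; apply: cent0.
have [u [v [w [cu cv cw]]]] := prime_act hB pp px xx0 c.
have right_coset y : gen x (star y c) -> exists k, lam y c = c + x *+ k.
  move=> /(gen_conj hB c)/(prime_gen pp px)/(_ xx0)[k].
  by rewrite starE baddA -!baddA !addE => e; exists k; rewrite -e !addE.
have [j cc] := right_coset c gcc.
have [f xc] := right_coset x (gen_starl hB c (mem_gen x)).
have shift k : x *+ k + c = c + x *+ (v * k).
  by apply: (@baddI _ (- c)); rewrite (conj_nmul _ cv) -nmulA !addE.
have inj := prime_inj pp px x0.
have E1 : (v + f = u * w %[mod p])%N.
  apply: inj; apply: (@baddI _ c); rewrite nmulD baddA -[v]muln1 -shift nmul1.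
  by rewrite -baddA -xc -mul_lam conjgC cw mul_lam lam_nmul cu -nmulA.
have lx k : lam x (x *+ k) = x *+ k by rewrite lam_nmul star0_lam.
have E2 : ((u * w) * (u * w) = v * v + f * v + f %[mod p])%N.
  have : x * (c * c) = (c * c) * x ^ (c * c) by rewrite conjgC.
  have -> : x ^ (c * c) = x *+ (w ^ 2) by rewrite -expg2 (expg_conj xx0 _ cw).
  rewrite [RHS]mul_lam lam_nmul -expg2 (lam_expg _ cu) expg2.
  have -> : c * c = c + c + x *+ j by rewrite mul_lam cc baddA.
  have cshift k y : x *+ k + (c + y) = c + (x *+ (v * k) + y).
    by rewrite baddA shift -baddA.
  rewrite mul_lam !lamD xc lx -nmulA -!baddA -{1}[x]nmul1 !cshift -!nmulD.
  move=> /baddI/baddI/inj h; apply/eqP; rewrite -(eqn_modDr j); apply/eqP.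
  have -> : (v * v + f * v + f + j = v * (v * 1) + (v * f + (f + j)))%N by ring.
  by rewrite h; congr modn; ring.
have E3 : (f * (v + f) = f %[mod p])%N.
  have : ((v + f) * (v + f) = v * v + f * v + f %[mod p])%N.
    by rewrite -E2 -[LHS]modnMm E1 modnMm.
  have -> : ((v + f) * (v + f) = v * v + f * v + f * (v + f))%N by ring.
  by move=> /eqP; rewrite eqn_modDl => /eqP.
have pu : ~~ (p %| u)%N.
  apply/negP=> /dvdnP[k uE]; apply: x0; apply: (@lam_inj _ c).
  by rewrite cu lam0 uE mulnC nmulA px nmul0b.
have star0P e : star e e = 0 -> cent x e by apply: (star0_cent hB pp px xx0).
(* If f + u <> 1 and lam_c c = c + j x, then e = c o k x satisfies e * e = 0
   as soon as u (f + u - 1) k = - j; p.-1 stands for - 1 to stay in nat. *)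
have [fu|fu] := eqVneq ((f + u) %% p)%N (1 %% p)%N; last first.
  have p0 := prime_gt0 pp.
  have pt : ~~ (p %| f + u + p.-1)%N.
    apply: contra fu => /dvdnP[k hk]; rewrite -(eqn_modDr p.-1) hk.
    by rewrite add1n prednK // modnMl modnn.
  have [k kE] : exists k, (u * (f + u + p.-1) * k + j = 0 %[mod p])%N.
    by apply: mod_solve; rewrite Euclid_dvdM // negb_or pu.
  pose e := c * (x *+ k).
  have eE : e = c + x *+ (u * k) by rewrite /e mul_lam lam_nmul cu -nmulA.
  have ee : lam e e = e.
    rewrite {1}/e lamM {1}eE lamD lam_nmul.
    have -> : lam (x *+ k) x = x.
      by rewrite -(star0_expg xx0) -[X in lam _ X]nmul1 star0_lamX // nmul1.
    have -> : lam (x *+ k) c = c + x *+ (f * k).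
      rewrite -(star0_expg xx0); elim: (k) => [|i IH].
        by rewrite expg0 lam1 muln0 nmul0 !addE.
      rewrite expgS lamM IH lamD xc lx -baddA -nmulD.
      by rewrite mulnS.
    rewrite !lamD !lam_nmul cc cu -!nmulA -!baddA -!nmulD eE; congr (_ + _).
    apply: (nmul_mod px); apply/eqP; rewrite -(eqn_modDr (p.-1 * (u * k))).
    rewrite -mulSn prednK // modnMr.
    have <- : (u * (f + u + p.-1) * k + j =
       j + (u * (f * k) + u * (u * k)) + p.-1 * (u * k))%N by ring.
    by rewrite kE mod0n.
  have [h1 h2 h3] : cent x e by apply/star0P/star_eq0.
  split.
  - rewrite -{2}h1 /e lamM; congr (lam c _).
    by rewrite -(star0_expg xx0) -[X in _ = lam _ X]nmul1 star0_lamX // nmul1.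
  - apply: (@baddIr _ (x *+ (u * k))); rewrite -baddA -eE h2 eE -!baddA.
    by rewrite -nmulSr nmulS.
  - apply: (@mulIg B (x ^+ k)); rewrite -mulgA (star0_expg xx0) -/e h3 /e.
    by rewrite -(star0_expg xx0) -!mulgA -expgSr expgS.
(* If f + u = 1, the element e is the p-th power of c. *)
suff h : star (c ^+ p) (c ^+ p) = 0.
  by apply: (@cent_exp_p _ hB x p pp px xx0 c 1); rewrite expn1; apply: star0P.
have {}fu : (f + u = 1 %[mod p])%N by [].
have : (p %| f)%N || ((v + f) %% p == 1 %% p)%N.
  have [vf0|vf0] := posnP (v + f).
    by move/eqP: vf0; rewrite addn_eq0 => /andP[_ /eqP->]; rewrite dvdn0.
  rewrite eqn_mod_dvd // -Euclid_dvdM // mulnBr muln1 -eqn_mod_dvd ?E3 //.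
  by apply: leq_pmulr.
case/orP=> [/dvdnP[k fE]|/eqP vf].
  have u1 : (u = 1 %[mod p])%N by rewrite -fu fE modnMDl.
  apply: (@lam_expg_star0 _ p j c x) => //.
  by rewrite cu (nmul_mod px u1) nmul1.
have uv : (u = v %[mod p])%N.
  by apply/eqP; rewrite -(eqn_modDl f) [(f + v)%N]addnC fu vf.
have [i iE] : exists i, x *+ j = - c + (x *+ i + c).
  have gxj : gen x (x *+ j) by apply: (sbrMn (gen_sub x)); apply: mem_gen.
  have [i iE] := prime_gen pp px (gen_conjN hB c gxj) xx0.
  by exists i; rewrite -iE -!baddA !addE.
apply: (@rlam_expg_star0 _ p i c x) => //.
  by rewrite rlamE cu (nmul_mod px uv) -cv -!baddA !addE.
by rewrite rlamE cc iE -!baddA !addE.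
Qed.

(** Now that c is known to act trivially on <x>, the displacement of c under
    lam_c is killed by a p-th power. *)
Lemma star_exp_p_eq0 c : gen x (star c c) -> star (c ^+ p) (c ^+ p) = 0.
Proof.
move=> gcc; have [cx _ _] := cent_mod_prime gcc.
have /(prime_gen pp px)/(_ xx0)[j jE] := gen_conj hB c gcc.
apply: (@lam_expg_star0 _ p j c x) => //.
by rewrite -jE starE -!baddA !addE.
Qed.

End Base.

(** The trace left in B by a finite series of ideals with trivial factors, in a
    form that quotients inherit. *)
Definition star_nil (B : skewBraceType) :=
  exists n, forall c : B, iter n (fun y => star y y) c = 0.

Section PPower.
Variable p : nat.
Hypothesis pp : prime p.

Lemma gen_eq0 (B : skewBraceType) (y : B) : gen 0 y -> y = 0.
Proof.
have z0 : star 0 0 = 0 :> B by rewrite starE lam0 !addE.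
by move=> /(gen_star0 z0)[n []] ->; rewrite nmul0b ?oppb0.
Qed.

Lemma star0_X (B : skewBraceType) (c : B) n :
  star c c = 0 -> star (c ^+ n) (c ^+ n) = 0.
Proof. by move=> cc; apply/star_eq0; rewrite {2 3}star0_expg ?star0_lamX. Qed.

Lemma iter_mem (B : skewBraceType) (S : set B) (c : B) n :
  is_sub_skew_brace S -> S c -> S (iter n (fun y => star y y) c).
Proof. by move=> hS Sc; elim: n => //= n IH; apply: sbr_star. Qed.

Lemma proj_iter (B : skewBraceType) (I : ideal B) (c : B) n :
  brace_proj I (iter n (fun y => star y y) c) =
  iter n (fun y => star y y) (brace_proj I c).
Proof. by elim: n => //= n IH; rewrite proj_star IH. Qed.

(** Induction on the order p ^ M of <x>: modulo the subgroup of order p, then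
    in it by [star_exp_p_eq0]. *)
Lemma star_exp_pow (M : nat) (B : skewBraceType) (hB : Dedekind B) (x c : B) :
  star x x = 0 -> x *+ (p ^ M) = 0 -> gen x (star c c) ->
  exists N, star (c ^+ (p ^ N)) (c ^+ (p ^ N)) = 0.
Proof.
elim: M B hB x c => [|M IH] B hB x c xx0 px gcc.
  exists 0%N; rewrite expg1; apply: gen_eq0.
  by move: gcc; rewrite -[x]nmul1 px.
pose y := x *+ (p ^ M).
have yy0 : star y y = 0 by rewrite /y -star0_expg //; apply: star0_X.
have py : y *+ p = 0 by rewrite /y -nmulA -expnSr.
pose I := gen_ideal hB y.
have hQ := Dedekind_quotient (I := I) hB.
have [||| N hN] := IH _ hQ (brace_proj I x) (brace_proj I c).
- by rewrite -proj_star xx0.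
- by rewrite -proj_nmul; apply/proj_eq0; apply: mem_gen.
- by rewrite -proj_star; apply: proj_gen.
exists N.+1; rewrite expnSr expgnA; apply: (@star_exp_p_eq0 _ hB y) => //.
by apply/(@proj_eq0 _ I); rewrite proj_star projX.
Qed.

(** Induction on the length of the sequence of self-stars of c: work modulo its
    last nonzero term z, which has p-power order, then apply
    [star_exp_pow] to z. *)
Lemma star_exp_ppower (n : nat) (B : skewBraceType) (hB : Dedekind B) (c : B) :
  iter n (fun y => star y y) c = 0 ->
  (forall y, gen (star c c) y -> exists M, y ^+ (p ^ M) = 1) ->
  exists N, star (c ^+ (p ^ N)) (c ^+ (p ^ N)) = 0.
Proof.
case: n => [/= ->|n].
  by exists 0%N; rewrite expg1 starE lam0 !addE.
elim: n B hB c => [|n IH] B hB c cn hp; first by exists 0%N; rewrite expg1.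
pose z := iter n.+1 (fun y => star y y) c.
have zz0 : star z z = 0 by [].
have [|M zM] := hp z.
  by rewrite /z iterSr; exact: (iter_mem _ (gen_sub _) (mem_gen _)).
pose I := gen_ideal hB z.
have [||N hN] := IH _ (Dedekind_quotient (I := I) hB) (brace_proj I c).
- by rewrite -proj_iter; apply/proj_eq0; apply: mem_gen.
- move=> Y; rewrite -proj_star => /gen_proj[y /hp[L yL] <-].
  by exists L; rewrite -projX yL.
have [|||N' hN'] := @star_exp_pow M _ hB z (c ^+ (p ^ N)) => //.
- by rewrite -star0_expg // zM zero_one.
- by apply/(@proj_eq0 _ I); rewrite proj_star projX.
by exists (N + N')%N; rewrite expnD expgnA.
Qed.

Section Monolith.
Variables (B : skewBraceType) (hB : Dedekind B) (x : B).
Implicit Types c d y : B.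
Hypotheses (x0 : x <> 0) (px : x *+ p = 0).
Hypothesis mono : forall c, c <> 0 -> gen c x.

(** A nonzero subgroup of the cyclic group <d> contains x, of order p. So <d>
    is finite, and its part prime to p is 0. *)
Lemma monolith_star0 d : star d d = 0 -> exists M, d ^+ (p ^ M) = 1.
Proof.
move=> dd; have [d0|d0] := pselect (d = 0).
  by exists 0%N; rewrite expg1 d0 zero_one.
have dvd e k m :
    x = e *+ k \/ x = - (e *+ k) -> e *+ m = 0 -> x *+ m = 0.
  move=> xe em; have ekm : e *+ k *+ m = 0 by rewrite nmulAC em nmul0b.
  case: xe => -> //; have -> (y : B) : (- y) *+ m = - (y *+ m).
    exact: (@expVgn (additive_group B)).
  by rewrite ekm oppb0.
have [i xE] := gen_star0 dd (mono d0).
have i0 : (0 < i)%N.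
  by case: i xE => // -[] xE; case: x0; rewrite xE nmul0 ?oppb0.
have di : d *+ (i * p) = 0.
  rewrite nmulA; case: xE => xE; first by rewrite -xE.
  rewrite -[d *+ i]oppbK -xE; have -> : (- x) *+ p = - (x *+ p).
    exact: (@expVgn (additive_group B)).
  by rewrite px oppb0.
have ip0 : (0 < i * p)%N by rewrite muln_gt0 i0 prime_gt0.
have [m cpm mE] := pfactor_coprime pp ip0.
set a := logn p _ in mE; exists a.
pose e := d ^+ (p ^ a); have ee : star e e = 0 by apply: star0_X.
have em : e *+ m = 0.
  by rewrite -star0_expg // /e -expgnA mulnC -mE star0_expg.
apply: contrapT => e1; have e0 : e <> 0 by rewrite zero_one.
have [k xk] := gen_star0 ee (mono e0).
have /(prime_dvd pp px x0) := dvd e k m xk em.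
by apply/negP; rewrite -prime_coprime.
Qed.

(** A power of c whose exponent is a power of p generates a trivial brace by
    [star_exp_ppower], so it has p-power order by [monolith_star0]; this
    covers <c> modulo <c * c>, and induction covers <c * c>. *)
Lemma monolith_pgroup n c : iter n (fun y => star y y) c = 0 ->
  forall y, gen c y -> exists M, y ^+ (p ^ M) = 1.
Proof.
elim: n c => [|n IH] c.
  by move=> /= -> y /gen_eq0 ->; exists 0%N; rewrite expg1 zero_one.
move=> cn; have hp := IH (star c c); rewrite -iterSr in hp; have {}hp := hp cn.
have [N /monolith_star0[L]] := star_exp_ppower hB cn hp.
rewrite -expgnA -expnD; set K := (N + L)%N => cK y cy.
pose I := gen_ideal hB (star c c); pose q := brace_proj I.
have qcc : star (q c) (q c) = 0.
  by rewrite -proj_star; apply/proj_eq0; apply: mem_gen.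
have qcK : q c ^+ (p ^ K) = 1 by rewrite -projX cK.
have qyK : q y ^+ (p ^ K) = 1.
  have [k] : exists k, q y = q c *+ k \/ q y = - (q c *+ k).
    by apply: (gen_star0 qcc); apply: proj_gen.
  rewrite -star0_expgV // -star0_expg // => -[] ->.
    by rewrite expgnAC qcK expg1n.
  by rewrite expVgn expgnAC qcK expg1n invg1.
have [|M yM] := hp (y ^+ (p ^ K)).
  by apply/(@proj_eq0 _ I); rewrite projX qyK zero_one.
by exists (K + M)%N; rewrite expnD expgnA.
Qed.

End Monolith.

(** Let K be maximal among the sub-skew braces avoiding x. Modulo K, every
    nonzero sub-skew brace contains x, so [monolith_pgroup] and Fermat's little
    theorem make x central modulo K; as commutators with x also lie in <x>,
    which meets K in 0, they vanish. *)
Lemma prime_order_center (B : skewBraceType) (hB : Dedekind B) (x : B) :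
  star_nil B -> star x x = 0 -> x *+ p = 0 -> center x.
Proof.
move=> [n hn] xx0 px; apply/centerE => c.
have [->|x0] := pselect (x = 0); first exact: cent0.
pose P (K : set B) := (K = set0 \/ is_sub_skew_brace K) /\ ~ K x.
have [|K [[hK nKx] maxK]] := @Zorn_bigcup B P.
  (* The empty set belongs to P so that the union of the empty chain does. *)
  move=> F FP tot; split; last by move=> [K FK]; case: (FP _ FK).
  have [[K [FK K0]]|noK] := pselect (exists K, F K /\ K 0); last first.
    left; apply/seteqP; split=> // y [K FK Ky].
    case: (FP _ FK) => -[K0|hK] _; first by rewrite K0 in Ky.
    by case: noK; exists K; split=> //; apply: sbr0.
  have subF L y : F L -> L y -> is_sub_skew_brace L.
    by move=> FL Ly; case: (FP _ FL) => -[L0|//]; rewrite L0 in Ly.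
  have two y z : (\bigcup_(X in F) X) y -> (\bigcup_(X in F) X) z ->
      exists L, [/\ F L, L y, L z & is_sub_skew_brace L].
    move=> [L FL Ly] [L' FL' Lz]; have [LL|LL] := tot _ _ FL FL'.
      by exists L'; split=> //; [apply: LL|apply: subF Lz].
    by exists L; split=> //; [apply: LL|apply: subF Ly].
  right; apply: sub_braceP => [|y z hy hz|y hy|y z hy hz|y hy].
  - by exists K.
  - have [L [FL Ly Lz hL]] := two _ _ hy hz.
    by exists L => //; apply: sbrD.
  - have [L [FL Ly Lz hL]] := two _ _ hy hy.
    by exists L => //; apply: sbrN.
  - have [L [FL Ly Lz hL]] := two _ _ hy hz.
    by exists L => //; apply: sbrM.
  - have [L [FL Ly Lz hL]] := two _ _ hy hy.
    by exists L => //; apply: sbrV.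
have {}hK : is_sub_skew_brace K.
  case: hK => // K0; exfalso.
  have [] := maxK (gen 0); last first.
    by split; [right; apply: gen_sub|move/gen_eq0].
  rewrite K0; split=> // h; have := h 0 (mem_gen 0); by [].
pose I := ded_ideal hB hK; pose q := brace_proj I.
have qx0 : q x <> 0 by move/proj_eq0.
have qpx : q x *+ p = 0 by rewrite -proj_nmul px.
have qxx : star (q x) (q x) = 0 by rewrite -proj_star xx0.
have hQ := Dedekind_quotient (I := I) hB.
have mono Y : Y <> 0 -> gen Y (q x).
  have [y ->] := projP Y => y0; apply: contrapT => nx.
  have hS := preim_sub (gen_sub (brace_proj I y)).
  apply: (maxK _ _ (conj (or_intror hS) nx)); split; last first.
    move=> /(_ y (mem_gen _)) Ky; apply: y0; exact/proj_eq0.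
  move=> z /(@proj_eq0 _ I) Kz; rewrite /preimage /= Kz.
  exact: (sbr0 (gen_sub _)).
have [|M qcM] :=
  monolith_pgroup hQ qx0 qpx mono (n := n) (c := q c) _ (mem_gen _).
  by rewrite -proj_iter hn.
have [h1 h2 h3] : cent (q x) (q c).
  apply: (@cent_exp_p _ hQ _ p pp qpx qxx _ M); rewrite qcM; split.
  - exact: lam1.
  - by rewrite -zero_one !addE.
  - by rewrite mulg1 mul1g.
have disj y : gen x y -> q y = 0 -> y = 0.
  move=> gy /(@proj_eq0 _ I) Ky; apply: contrapT => y0; apply: nKx.
  by have [k ->] := prime_gen_sym pp px xx0 gy y0; apply: (sbrMn hK).
apply/centP => y xcy; apply: disj; first exact: (commutators_genl hB xcy).
by apply/proj_eq0; apply: (iffLR (proj_cent _ _ _) (And3 h1 h2 h3)).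
Qed.

End PPower.

(** * Elements of infinite order, and the torsion ideal *)

Lemma star_nil_quotient (B : skewBraceType) (I : ideal B) :
  star_nil B -> star_nil (quotient_brace I).
Proof.
by move=> [n hn]; exists n => X; have [x ->] := projP X; rewrite -proj_iter hn.
Qed.

Lemma center_lam (B : skewBraceType) (z b : B) : center z -> lam z b = b.
Proof. by case=> [[h _] _]; apply: h. Qed.

Definition infinite_order (B : skewBraceType) (a : B) :=
  forall n, a *+ n = 0 -> n = 0%N.

Section InfiniteOrder.
Variables (B : skewBraceType) (hB : Dedekind B).
Hypothesis (nB : star_nil B).
Implicit Types a c d x y z : B.

Lemma infinite_order_inj a m n : infinite_order a -> a *+ m = a *+ n -> m = n.
Proof.
move=> ai; wlog le : m n / (m <= n)%N.
  by move=> h; case/orP: (leq_total m n) => le e; [|apply/esym]; apply: h.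
rewrite -(subnK le) nmulD -{1}[a *+ m]badd0l => /baddIr/esym/ai ->.
by rewrite add0n.
Qed.

Lemma infinite_order_gen_nmul a k n : star a a = 0 -> infinite_order a ->
  gen (a *+ k) (a *+ n) -> exists m, n = (k * m)%N.
Proof.
move=> aa ai; have kk : star (a *+ k) (a *+ k) = 0.
  by rewrite -star0_expg //; apply: star0_X.
move=> /(gen_star0 kk)[m [|] e].
  by exists m; apply: (infinite_order_inj ai); rewrite e nmulA.
have: a *+ (n + k * m) = 0 by rewrite nmulD e nmulA !addE.
move/ai/eqP; rewrite addn_eq0 => /andP[/eqP-> _].
by exists 0%N; rewrite muln0.
Qed.

Lemma infinite_order_gen_prime a y : star a a = 0 -> infinite_order a ->
  gen a y -> (forall q, prime q -> gen (a *+ q) y) -> y = 0.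
Proof.
move=> aa ai /(gen_star0 aa)[n yE] yq.
suff n0 : n = 0%N by case: yE => ->; rewrite n0 nmul0 ?oppb0.
have [q nq qp] := prime_above n.
have : gen (a *+ q) (a *+ n).
  case: yE => yE; rewrite -?yE; first exact: yq.
  by rewrite -[_ *+ n]oppbK -yE; apply: (sbrN (gen_sub _)); apply: yq.
move=> /(infinite_order_gen_nmul aa ai)[m nE].
by case: m nE => [|m] nE; [rewrite nE muln0|move: nq; rewrite nE mulnS; lia].
Qed.

(** Modulo the ideal <q a> the element a has prime order, hence is central; so
    a commutator with a lies in <q a> for all primes q, and is 0. *)
Lemma infinite_order_center a : star a a = 0 -> infinite_order a -> center a.
Proof.
move=> aa ai; apply/centerE => c.
apply/centP => y acy; apply: (infinite_order_gen_prime aa ai).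
  exact: (commutators_genl hB acy).
move=> q qp; pose I := gen_ideal hB (a *+ q); pose p := brace_proj I.
have pa : center (p a).
  apply: (@prime_order_center q) => //.
  - exact: Dedekind_quotient.
  - exact: star_nil_quotient.
  - by rewrite -proj_star aa.
  - by rewrite -proj_nmul; apply/proj_eq0; apply: mem_gen.
exact: (iffLR (center_projP I a) pa c).
Qed.

(** By [infinite_order_center], z is central, so lam_y y = y + z. For d = y o y
    this gives d * y = 2 z and d * d = 4 z. As <d> is an ideal it contains 2 z,
    although modulo <4 z> it is the cyclic group of the powers of d. As 2 z and
    4 z are central, a power d^k congruent to 2 z is central, so it fixes y,
    whereas it moves y by 2 k z; hence k = 0, and 2 z lies in <4 z>, which is
    absurd. *)
Lemma star_self_torsion y z : z = star y y -> star z z = 0 ->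
  infinite_order z -> False.
Proof.
move=> zE zz zi; have zc := infinite_order_center zz zi.
have zcent b : cent z b by move: b; apply/centerE.
have yz : lam y y = y + z.
  by have [_ <- _] := zcent y; rewrite zE starE -baddA !addE.
have lz b k : lam b (z *+ k) = z *+ k.
  by rewrite lam_nmul; have [-> _ _] := zcent b.
have lz1 b : lam b z = z by have [-> _ _] := zcent b.
have zy b : z + b = b + z by have [_ -> _] := zcent b.
pose d := y * y.
have dy : lam d y = y + z *+ 2.
  by rewrite /d lamM yz lamD yz lz1 -baddA.
have dky k : lam (d ^+ k) y = y + z *+ (2 * k).
  elim: k => [|k IH]; first by rewrite expg0 lam1 muln0 nmul0 !addE.
  by rewrite expgS lamM IH lamD dy lz -baddA -nmulD mulnS.
have zA w : z + (y + w) = y + (z + w) by rewrite !baddA zy.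
have ddE : star d d = z *+ 4.
  have dE : d = y + (y + z) by rewrite /d mul_lam yz.
  have lamdd : lam d d = z *+ 4 + d.
    rewrite [in X in lam _ X]dE !lamD dy lz1 dE !nmulS nmul0 !badd0r -!baddA.
    by rewrite !zA.
  by rewrite starE lamdd baddK.
pose J := gen_ideal hB (z *+ 4); pose p := brace_proj J.
have pdd : star (p d) (p d) = 0.
  by rewrite -proj_star ddE; apply/proj_eq0; apply: mem_gen.
have z2c : center (z *+ 2) by apply: (sbrMn (center_subgroup B)).
have z2d : gen d (z *+ 2).
  have -> : z *+ 2 = star d y.
    by have /centerP[_ zC _] := z2c; rewrite starE dy -zC baddK.
  by apply: gen_starl => //; apply: mem_gen.
have Jc : ideal_set J `<=` @center B.
  apply: gen_min; first exact: center_subgroup.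
  by apply: (sbrMn (center_subgroup B)).
have nz2 : p (z *+ 2) <> 0.
  move/proj_eq0/(infinite_order_gen_nmul (k := 4) zz zi)=> [m].
  move/(congr1 (modn^~ 4)).
  by rewrite modnMr.
have dkc k : center (d ^+ k) -> k = 0%N.
  move=> h; have := center_lam y h; rewrite dky -{2}[y]badd0r => /baddI/zi/eqP.
  by rewrite muln_eq0 => /eqP.
have [k] : exists k, p (z *+ 2) = p d *+ k \/ p (z *+ 2) = - (p d *+ k).
  by apply: (gen_star0 pdd); apply: proj_gen.
rewrite -(star0_expgV pdd) -(star0_expg pdd) => hk; apply: nz2.
suff k0 : k = 0%N.
  by move: hk; rewrite k0 => -[] ->; rewrite ?invg1 ?expg0 -zero_one.
apply: dkc; case: hk => hk.
  have : center ((d ^+ k)^-1 * (z *+ 2)).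
    apply: Jc; apply/(@proj_eq0 _ J).
    by rewrite brace_projM brace_projV projX -!/(p _) hk mulVg zero_one.
  move=> /(sbrV (center_subgroup B)); rewrite invgM invgK => h.
  by have := sbrM (center_subgroup B) z2c h; rewrite mulVKg.
have : center (d ^+ k * (z *+ 2)).
  apply: Jc; apply/(@proj_eq0 _ J).
  by rewrite brace_projM projX -!/(p _) hk mulgV zero_one.
move=> h; have := sbrM (center_subgroup B) h (sbrV (center_subgroup B) z2c).
by rewrite mulgK.
Qed.
End InfiniteOrder.

Lemma finite_expg_eq1 (G : groupType) (S : set G) (x : G) :
  finite_set S -> (forall n, S (x ^+ n)) -> exists2 n, (0 < n)%N & x ^+ n = 1.
Proof.
move=> fS Sx; apply: contrapT => nx; apply: infinite_nat.
have -> : [set: nat] = (fun n => x ^+ n) @^-1` S.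
  by apply/seteqP; split=> n _ //; apply: Sx.
apply: finite_preimage => // m n _ _.
wlog le : m n / (m <= n)%N.
  by move=> h; case/orP: (leq_total m n) => le e; [|apply/esym]; apply: h.
rewrite -(subnK le) expgnDr -{1}[x ^+ m]mul1g => /mulIg/esym h.
case: (posnP (n - m)) => [->//|nm].
by case: nx; exists (n - m)%N.
Qed.

Lemma finite_preim_proj (B : skewBraceType) (I : ideal B)
    (S : set (quotient_brace I)) :
  finite_set (ideal_set I) -> finite_set S -> finite_set (brace_proj I @^-1` S).
Proof.
move=> fI fS; pose f (u : quotient_brace I * B) := repr u.1 + u.2.
apply: (@sub_finite_set _ _ (f @` (S `*` ideal_set I))); last first.
  exact/finite_image/finite_setX.
move=> y Sy; exists (brace_proj I y, - repr (brace_proj I y) + y).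
  by split=> //=; apply/proj_eqP; rewrite /brace_proj reprK.
by rewrite /f /= addbNK.
Qed.

Section Torsion.
Variables (B : skewBraceType) (hB : Dedekind B).
Implicit Types c x y z : B.

Lemma star0_gen_finite c m : star c c = 0 -> (0 < m)%N -> c *+ m = 0 ->
  finite_set (gen c).
Proof.
move=> cc m0 cm; pose P := [set c *+ k | k in `I_m].
apply: (@sub_finite_set _ _ (P `|` [set - y | y in P])).
  have mE k : c *+ k = c *+ (k %% m).
    by apply: (nmul_mod cm); rewrite modn_mod.
  move=> y /(gen_star0 cc)[k [|] ->].
    by left; exists (k %% m)%N; [apply: ltn_pmod|rewrite -mE].
  right; exists (c *+ k) => //.
  by exists (k %% m)%N; [apply: ltn_pmod|rewrite -mE].
by rewrite finite_setU; split; do ?apply: finite_image; apply: finite_II.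
Qed.

Lemma gen_proj_finite (I : ideal B) c : finite_set (ideal_set I) ->
  finite_set (gen (brace_proj I c)) -> finite_set (gen c).
Proof.
move=> fI fc; apply: sub_finite_set (finite_preim_proj fI fc).
by move=> y; apply: proj_gen.
Qed.

End Torsion.

(** The last nonzero term z of the sequence of self-stars of c has finite order
    by [star_self_torsion]; one then proceeds modulo the finite ideal <z>. *)
Lemma star_gen_finite (B : skewBraceType) (hB : Dedekind B) (nB : star_nil B)
  (c : B) : finite_set (gen (star c c)).
Proof.
have [n hn] := nB; have: iter n.+1 (fun y => star y y) c = 0 by rewrite iterSr.
elim: n {hn} B hB nB c => [|n IH] B hB nB c cn.
  move: cn => /= ->; apply: sub_finite_set (finite_set1 0).
  by move=> y /gen_eq0.
pose z := iter n.+1 (fun y => star y y) c.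
have zz : star z z = 0 by [].
have [m m0 zm] : exists2 m, (0 < m)%N & z *+ m = 0.
  apply: contrapT => h; apply: (star_self_torsion hB nB (erefl z) zz).
  move=> m zm; apply/eqP; rewrite -leqn0 leqNgt; apply/negP => m0.
  by apply: h; exists m.
pose I := gen_ideal hB z.
apply: (@gen_proj_finite _ I); first exact: star0_gen_finite zm.
rewrite proj_star; apply: IH; first exact: Dedekind_quotient.
  exact: star_nil_quotient.
by rewrite -proj_iter; apply/proj_eq0; apply: mem_gen.
Qed.

Section TorsionIdeal.
Variables (B : skewBraceType) (hB : Dedekind B) (nB : star_nil B).
Implicit Types c x y z : B.

(** Finiteness of <x> is stable under sums and products, and amounts to x
    having finite order in either of the two groups. *)
Definition torsion : set B := [set x | finite_set (gen x)].

Lemma torsion_nmul x : torsion x -> exists2 n, (0 < n)%N & x *+ n = 0.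
Proof.
move=> fx; apply: (@finite_expg_eq1 (additive_group B) (gen x) x fx) => n.
by apply: (sbrMn (gen_sub x)); apply: mem_gen.
Qed.

Lemma torsion_expg x : torsion x -> exists2 n, (0 < n)%N & x ^+ n = 1.
Proof.
move=> fx; apply: (@finite_expg_eq1 B (gen x) x fx) => n.
by apply: (sbrX (gen_sub x)); apply: mem_gen.
Qed.

Lemma nmul_torsion c m : (0 < m)%N -> c *+ m = 0 -> torsion c.
Proof.
move=> m0 cm; pose I := gen_ideal hB (star c c).
apply: (@gen_proj_finite _ I); first exact: star_gen_finite.
apply: (@star0_gen_finite _ _ m) => //.
  by rewrite -proj_star; apply/proj_eq0; apply: mem_gen.
by rewrite -proj_nmul cm.
Qed.

Lemma torsion_sub : is_sub_skew_brace torsion.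
Proof.
have mem2 x y w : torsion x -> torsion y -> brace_proj (gen_ideal hB x) w =
    brace_proj (gen_ideal hB x) y -> torsion w.
  move=> fx fy e; apply: (@gen_proj_finite _ (gen_ideal hB x)); first exact: fx.
  rewrite e.
  apply: sub_finite_set (finite_image (brace_proj (gen_ideal hB x)) fy).
  by move=> Y /gen_proj[z gz <-]; exists z.
have gx x : brace_proj (gen_ideal hB x) x = 0 by apply/proj_eq0; apply: mem_gen.
apply: sub_braceP => [|x y fx fy|x fx|x y fx fy|x fx].
- apply: sub_finite_set (finite_set1 0); by move=> y /gen_eq0.
- by apply: (mem2 x y) => //; rewrite brace_projD gx !addE.
- apply: sub_finite_set fx; apply: gen_min (gen_sub x) _.
  by apply: (sbrN (gen_sub x)); apply: mem_gen.
- by apply: (mem2 x y) => //; rewrite brace_projM gx zero_one mul1g.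
- apply: sub_finite_set fx; apply: gen_min (gen_sub x) _.
  by apply: (sbrV (gen_sub x)); apply: mem_gen.
Qed.

Definition torsion_ideal := ded_ideal hB torsion_sub.

(** Modulo the torsion ideal each c satisfies c * c = 0 by [star_gen_finite] and
    has infinite order unless it is 0, so [infinite_order_center] applies. *)
Lemma torsion_quotient_central c : center (brace_proj torsion_ideal c).
Proof.
have [tc|ntc] := pselect (torsion c).
  have -> : brace_proj torsion_ideal c = 0 by apply/proj_eq0.
  exact: (sbr0 (center_subgroup _)).
apply: infinite_order_center.
- exact: Dedekind_quotient.
- exact: star_nil_quotient.
- by rewrite -proj_star; apply/proj_eq0; apply: star_gen_finite.
- move=> n; rewrite -proj_nmul.
  move=> /(@proj_eq0 _ torsion_ideal)/torsion_nmul[m m0].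
  rewrite -nmulA => cnm; apply/eqP; rewrite -leqn0 leqNgt; apply/negP => n0.
  by apply: ntc; apply: nmul_torsion cnm; rewrite muln_gt0 n0.
Qed.

End TorsionIdeal.

(** * Series with trivial factors, and solubility *)

Section Factor.
Variables (B : skewBraceType) (I : ideal B).
Implicit Types (J : set B).

Lemma factor_trivialP J : is_trivial (factor I J) <->
  forall a b, J a -> J b -> ideal_set I (- (a + b) + a * b).
Proof.
split=> [h a b Ja Jb|h _ _ [a Ja <-] [b Jb <-]].
  apply/proj_eqP; rewrite brace_projD brace_projM.
  by apply: (h _ _ (ex_intro2 _ _ a Ja erefl) (ex_intro2 _ _ b Jb erefl)).
by rewrite -brace_projD -brace_projM; apply/proj_eqP/h.
Qed.

Lemma factor_abelianP J : is_abelian (factor I J) <->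
  is_trivial (factor I J) /\
  forall a b, J a -> J b -> ideal_set I (- (a + b) + (b + a)).
Proof.
split=> -[t h]; split=> //; last first.
  move=> _ _ [a Ja <-] [b Jb <-].
  by rewrite -!brace_projD; apply/proj_eqP/h.
move=> a b Ja Jb; apply/proj_eqP; rewrite !brace_projD.
by apply: (h _ _ (ex_intro2 _ _ a Ja erefl) (ex_intro2 _ _ b Jb erefl)).
Qed.
End Factor.

(** A self-star in a trivial factor vanishes, so each step of the series absorbs
    one self-star. *)
Lemma trivial_series_star_nil (B : skewBraceType) :
  has_trivial_ideal_series B -> star_nil B.
Proof.
move=> [n [I [I0 In hI]]]; exists n => c.
have : ideal_set (I n) c by rewrite In.
have : (n <= n)%N by [].
elim: {1 3 4}n c => [|k IH] c kn; first by rewrite I0.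
move=> Ic; rewrite iterSr; apply: IH; first exact: ltnW.
have [_ /factor_trivialP/(_ c c Ic Ic)] := hI k kn.
move=> /(ideal_conjN c); congr (ideal_set _ _).
by rewrite /star !addE -!baddA !addE.
Qed.

Lemma soluble_trivial_series (B : skewBraceType) :
  soluble B -> has_trivial_ideal_series B.
Proof.
move=> [n [I [I0 In hI]]]; exists n, I; split=> // i /hI[le [t _]]; by split.
Qed.

(** This uses a o b = a + lam_a b, and that the inverse of x in (B, o) is
    - lam_{x^-1} x. *)
Lemma lam_invariant_sub (B : skewBraceType) (S : set B) :
  is_subgroup (S : set (additive_group B)) ->
  (forall b x, S x -> S (lam b x)) -> is_sub_skew_brace S.
Proof.
move=> [h0 hD hN] hl; apply: sub_braceP => // [x y Sx Sy|x Sx].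
  by rewrite mul_lam; apply: hD => //; apply: hl.
have -> : x^-1 = - lam x^-1 x; last by apply/hN/hl.
by rewrite /lam mulVg -zero_one !addE.
Qed.

Lemma generated_subgroup (G : groupType) (X : set G) :
  is_subgroup (generated X).
Proof.
split=> [|x y hx hy|x hx] S [hS XS].
- by case: (hS).
- by case: (hS) => _ h _; apply: h; [apply: hx|apply: hy].
- by case: (hS) => _ _ h; apply: h; apply: hx.
Qed.

Lemma generated_min (G : groupType) (X S : set G) :
  is_subgroup S -> X `<=` S -> generated X `<=` S.
Proof. by move=> hS XS y; apply. Qed.

Section StarSet.
Variable B : skewBraceType.

Lemma mem_star_set (X Y : set B) x y : X x -> Y y -> star_set X Y (star x y).
Proof. by move=> Xx Yy S [_]; apply; exists x => //; exists y. Qed.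

(** The map lam_b sends x * y to x' * lam_b y, where x' = b o x o b^-1; so the
    star product of the two sets is lambda-invariant. *)
Lemma star_set_sub (X Y : set B) :
  (forall b x, X x -> X (x ^ b)) -> (forall b y, Y y -> Y (lam b y)) ->
  is_sub_skew_brace (star_set X Y).
Proof.
move=> XJ YL; apply: lam_invariant_sub; first exact: generated_subgroup.
move=> b.
have [h1 hM hV] := @generated_subgroup (additive_group B)
  [set star x y | x in X & y in Y].
apply: (@generated_min (additive_group B) _ (lam b @^-1` star_set X Y)).
  split=> [|x y Sx Sy|x Sx].
  - by change (star_set X Y (lam b 0)); rewrite lam0.
  - change (star_set X Y (lam b ((x : B) + y))).
    by rewrite lamD; apply: hM.
  - by change (star_set X Y (lam b (- (x : B)))); rewrite lamN; apply: hV.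
move=> _ [x Xx [y Yy <-]]; change (star_set X Y (lam b (star x y))).
have -> : lam b (star x y) = star (x ^ b^-1) (lam b y).
  by rewrite !starE lamD lamN -!lamM conjgE invgK -!mulgA mulVg mulg1.
by apply: mem_star_set; [apply: XJ|apply: YL].
Qed.

(** The identity - (a + b) + a o b = - b + (a * b) + b shows that a layer is
    trivial as soon as its star products fall into the next term. *)
Lemma star_series_trivial (hB : Dedekind B) (L : nat -> set B) n :
  L 0%N = setT -> L n = [set 0] -> (forall k, is_sub_skew_brace (L k)) ->
  (forall k, L k.+1 `<=` L k) ->
  (forall k a b, L k a -> L k b -> L k.+1 (star a b)) ->
  has_trivial_ideal_series B.
Proof.
move=> L0 Ln hL dL sL; exists n, (fun i => ded_ideal hB (hL (n - i)%N)).
split=> [||i ni]; rewrite /= ?subn0 ?subnn //.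
have -> : (n - i = (n - i.+1).+1)%N by rewrite subnSK.
split; first exact: dL.
apply/factor_trivialP => a b La Lb.
have := @ideal_conj _ (ded_ideal hB (hL (n - i.+1).+1)) b _ (sL _ _ _ La Lb).
congr (ideal_set _ _).
by rewrite starE mul_lam !addE -!baddA !addE.
Qed.

End StarSet.

Lemma nilpotent_trivial_series (B : skewBraceType) (hB : Dedekind B) :
  left_nilpotent B \/ right_nilpotent B -> has_trivial_ideal_series B.
Proof.
case=> -[n Ln].
  have hL k : is_sub_skew_brace (iter k (fun X => star_set setT X) [set: B]).
    elim: k => [|k IH]; first exact: sub_braceP.
    by apply: star_set_sub => // b y; apply: (@ideal_lam _ (ded_ideal hB IH)).
  apply: (star_series_trivial hB _ Ln hL) => // [k|k a b _ Lb].
    apply: (@generated_min (additive_group B)); first by case: (hL k).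
    move=> _ [x _ [y Ly <-]].
    exact: (@ideal_starr _ (ded_ideal hB (hL k))).
  exact: mem_star_set.
have hL k : is_sub_skew_brace (iter k (fun X => star_set X setT) [set: B]).
  elim: k => [|k IH]; first exact: sub_braceP.
  by apply: star_set_sub => // b y; apply: (@ideal_conjg _ (ded_ideal hB IH)).
apply: (star_series_trivial hB _ Ln hL) => // [k|k a b La _].
  apply: (@generated_min (additive_group B)); first by case: (hL k).
  move=> _ [x Lx [y _ <-]].
  exact: (@ideal_starl _ (ded_ideal hB (hL k))).
exact: mem_star_set.
Qed.

Section TrivialSub.
Variables (Q : skewBraceType) (hQ : Dedekind Q) (J : set Q).
Hypotheses (hJ : is_sub_skew_brace J) (tJ : is_trivial J).
Implicit Types a b x y : Q.

Lemma nmulN x n : (- x) *+ n = - (x *+ n).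
Proof. exact: (@expVgn (additive_group Q)). Qed.

Definition addJ g y : Q := - g + (y + g).
Lemma addJD a b y : addJ (a + b) y = addJ b (addJ a y).
Proof. by rewrite /addJ !addE -!baddA. Qed.
Lemma addJN g y : addJ g (- y) = - addJ g y.
Proof. by rewrite /addJ !addE -!baddA. Qed.
Lemma addJMn g y n : addJ g (y *+ n) = addJ g y *+ n.
Proof. exact: conj_nmul. Qed.
Lemma addJ_fix g y : addJ g y = y -> y + g = g + y.
Proof. by move=> {2}<-; rewrite /addJ addbNK. Qed.

Lemma trivial_star0 y : J y -> star y y = 0.
Proof. by move=> Jy; rewrite /star -baddA -(tJ Jy Jy) baddK baddNl. Qed.

(** As <y> is an ideal of Q, additive conjugations act on it as power maps,
    and power maps of a cyclic group commute. *)
Lemma trivial_conj_comm a b y : J y -> addJ (a + b) y = addJ (b + a) y.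
Proof.
move=> Jy; have yy := trivial_star0 Jy.
have pw g : exists n, addJ g y = y *+ n \/ addJ g y = - (y *+ n).
  by apply: (gen_star0 yy); apply: gen_conj => //; apply: mem_gen.
rewrite !addJD; have [n na] := pw a; have [m mb] := pw b.
case: na => na; case: mb => mb; rewrite na mb ?addJN !addJMn na mb ?nmulN.
- by rewrite nmulAC.
- by rewrite nmulAC.
- by rewrite nmulAC.
- by rewrite nmulAC.
Qed.

Lemma trivial_commutator_central a b y : J y ->
  (- (a + b) + (b + a)) + y = y + (- (a + b) + (b + a)).
Proof.
move=> Jy; symmetry; apply: addJ_fix; rewrite addJD -trivial_conj_comm.
  by rewrite -addJD baddNl /addJ !addE.
exact: (@ideal_conj _ (ded_ideal hQ hJ)).
Qed.

Definition trivial_center : set Q :=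
  [set x | J x /\ forall y, J y -> x + y = y + x].

Lemma trivial_center_sub : is_sub_skew_brace trivial_center.
Proof.
have hV x : J x -> x^-1 = - x.
  move=> Jx; apply: (@mulgI Q x).
  by rewrite mulgV -tJ ?baddNr ?zero_one //; apply: (sbrN hJ).
have cD x z : trivial_center x -> trivial_center z -> trivial_center (x + z).
  move=> [Jx xC] [Jz zC]; split=> [|y Jy]; first exact: (sbrD hJ).
  by rewrite -baddA zC // baddA xC // baddA.
have cN x : trivial_center x -> trivial_center (- x).
  move=> [Jx xC]; split=> [|y Jy]; first exact: (sbrN hJ).
  by rewrite -{1}[y]oppbK -oppbD -xC ?oppbD ?oppbK //; apply: (sbrN hJ).
apply: sub_braceP => // [|x z cx cz|x cx].
- by split=> [|y _]; [exact: (sbr0 hJ)|rewrite !addE].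
- by rewrite -tJ; [apply: cD|case: cx|case: cz].
- by rewrite hV; [apply: cN|case: cx].
Qed.

End TrivialSub.

Definition abelian_step (B : skewBraceType) (I J : ideal B) :=
  (ideal_set I `<=` ideal_set J) /\
  is_abelian (factor I (ideal_set J)).

(** Take for M / I the centre of J / I, which contains all commutators. *)
Lemma trivial_step_refine (B : skewBraceType) (hB : Dedekind B)
    (I J : ideal B) :
  (ideal_set I `<=` ideal_set J) -> is_trivial (factor I (ideal_set J)) ->
  exists2 M : ideal B, abelian_step I M & abelian_step M J.
Proof.
move=> IJ tJ; have hJ := im_sub I (ideal_sub J).
have hQ := Dedekind_quotient (I := I) hB.
pose M := ded_ideal hB (preim_sub (trivial_center_sub hJ tJ)).
have JP x : factor I (ideal_set J) (brace_proj I x) -> ideal_set J x.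
  move=> [y Jy /proj_eqP Ixy]; rewrite -(addbNK y x).
  by apply: (sbrD (ideal_sub J)) => //; apply: IJ.
have MJ : ideal_set M `<=` ideal_set J by move=> x [/JP].
have IM : ideal_set I `<=` ideal_set M.
  move=> x /proj_eq0 x0; rewrite /M /= /preimage /= x0.
  exact: (sbr0 (trivial_center_sub hJ tJ)).
move/factor_trivialP: (tJ) => tJ'.
exists M; split=> //; apply/factor_abelianP; split.
- by apply/factor_trivialP => a b /MJ Ja /MJ Jb; apply: tJ'.
- move=> a b [_ aC] /MJ Jb; apply/(@proj_eq0 _ I).
  by rewrite !(brace_projD, brace_projN) aC ?baddNl //; exists b.
- by apply/factor_trivialP => a b Ja Jb; apply/IM/tJ'.
- move=> a b Ja Jb.
  have JAB : factor I (ideal_set J) (brace_proj I (- (a + b) + (b + a))).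
    exists (- (a + b) + (b + a)) => //; have hJ' := ideal_sub J.
    by apply: (sbrD hJ'); [apply: (sbrN hJ')|]; apply: (sbrD hJ').
  split=> // Y JY; rewrite !(brace_projD, brace_projN).
  exact: (trivial_commutator_central hQ hJ tJ).
Qed.

Lemma trivial_series_soluble (B : skewBraceType) (hB : Dedekind B) :
  has_trivial_ideal_series B -> soluble B.
Proof.
move=> [n [I [I0 In hI]]].
have /choice[M hM] i : exists M : ideal B, (i < n)%N ->
    abelian_step (I i) M /\ abelian_step M (I i.+1).
  case: (ltnP i n) => [ni|_]; last by exists (I i).
  have [le t] := hI i ni; have [M h1 h2] := trivial_step_refine hB le t.
  by exists M.
pose K i := if odd i then M i./2 else I i./2.
exists n.*2, K; split; rewrite /K /= ?odd_double ?doubleK //.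
move=> i; rewrite -{1}(odd_double_half i) uphalfE /=.
case: (boolP (odd i)) => oi /= i2n.
  have /hM[_] : (i./2 < n)%N by rewrite -ltn_double; apply: ltn_trans i2n.
  by rewrite uphalf_half oi.
have /hM[] : (i./2 < n)%N by rewrite -ltn_double.
by rewrite uphalf_half (negbTE oi).
Qed.

(** * Upper central series *)

Lemma coprime_expg_mem (G : groupType) (S : set G) (x : G) m n :
  is_subgroup S -> coprime m n -> S (x ^+ m) -> S (x ^+ n) -> S x.
Proof.
move=> [h1 hM hV] + Sm Sn.
have SX y k : S y -> S (y ^+ k).
  by move=> Sy; elim: k => [|k IH]; rewrite ?expg0 // expgS; apply: hM.
have [->|m0] := posnP m.
  by rewrite /coprime gcd0n => /eqP n1; rewrite n1 in Sn.
case/(coprimeP _ m0) => -[a b] /= h.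
have hb : (m * a = 1 + n * b)%N by lia.
have : S (x ^+ (m * a)) by rewrite expgnA; apply: SX.
rewrite hb expgnDr expg1 expgnA => /hM/(_ (hV _ (SX _ b Sn))).
by rewrite mulgK.
Qed.

Lemma subgroup1 (G : groupType) : is_subgroup [set (1 : G)].
Proof.
by split=> // [x y -> ->|x ->]; [rewrite mulg1|rewrite invg1].
Qed.

Lemma coprime_nmul_eq0 (B : skewBraceType) (x : B) m n :
  coprime m n -> x *+ m = 0 -> x *+ n = 0 -> x = 0.
Proof.
exact: (@coprime_expg_mem (additive_group B) _ x m n (@subgroup1 _)).
Qed.

(** Let m be the part prime to p of the order of x. The power of x by m is not
    1, since otherwise S would contain x; it has p-power order, and some power
    of it has order p. *)
Lemma pi_group_quotient (G : groupType) (S : set G) (x : G) p n :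
  is_subgroup S -> prime p -> ~ S x -> S (x ^+ p) -> (0 < n)%N -> x ^+ n = 1 ->
  pi_group G p.
Proof.
move=> hS pp nSx Sp n0 xn; split=> //.
have [m cpm nE] := pfactor_coprime pp n0.
set l := logn p n in nE.
have xm1 : x ^+ m <> 1.
  move=> xm; apply: nSx; apply: (coprime_expg_mem hS cpm) => //.
  by rewrite xm; case: hS.
have : x ^+ m ^+ (p ^ l) = 1 by rewrite -expgnA -nE.
elim: l {nE} => [|l IH] yl; first by rewrite expg1 in yl.
have [/IH//|ne] := pselect (x ^+ m ^+ (p ^ l) = 1).
exists (x ^+ m ^+ (p ^ l)); split; first exact: prime_gt0.
  by rewrite -expgnA -expnSr.
move=> k /andP[k0 kp] wk; apply: ne.
apply: (coprime_expg_mem (@subgroup1 G) (m := k) (n := p)) => //.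
  by rewrite coprime_sym prime_coprime // gtnNdvd.
by rewrite /= -expgnA -expnSr.
Qed.

Lemma finite_exponent (B : skewBraceType) (S : set B) : finite_set S ->
  (forall y, S y -> exists2 n, (0 < n)%N & y *+ n = 0) ->
  exists2 M, (0 < M)%N & forall y, S y -> y *+ M = 0.
Proof.
move=> /finite_seqP[s ->] hs.
have [f fP] : exists f : B -> nat,
    forall y, y \in s -> (0 < f y)%N /\ y *+ f y = 0.
  have /choice[f fP] y : exists n, y \in s -> (0 < n)%N /\ y *+ n = 0.
    by have [/hs[n]|] := boolP (y \in s); [exists n|exists 0%N].
  by exists f.
exists (\prod_(y <- s) f y)%N.
  by rewrite big_seq; apply: prodn_cond_gt0 => y /fP[].
move=> y /= ys; rewrite (big_rem y) //= nmulA.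
by have [_ ->] := fP y ys; rewrite nmul0b.
Qed.

Section UpperCentral.
Variable B : skewBraceType.
Implicit Types (I : ideal B) (x c : B).

Lemma upper_centralS k x : ideal_set (upper_central B k.+1) x <->
  center (brace_proj (upper_central B k) x).
Proof. by []. Qed.

Lemma upper_central_le k m x : (k <= m)%N ->
  ideal_set (upper_central B k) x -> ideal_set (upper_central B m) x.
Proof.
move=> /subnK <-; elim: (m - k)%N => // n IH /IH h; rewrite addSn.
apply/upper_centralS; move/proj_eq0: h => ->.
exact: (sbr0 (center_subgroup _)).
Qed.

End UpperCentral.

Lemma upper_central_quotient (B : skewBraceType) (I : ideal B) m
    (hI : ideal_set I `<=` ideal_set (upper_central B m)) j y :
  ideal_set (upper_central (quotient_brace I) j) (brace_proj I y) ->
  ideal_set (upper_central B (m + j)) y.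
Proof.
elim: j y => [|j IH] y; first by move=> /proj_eq0 /hI; rewrite addn0.
move=> /upper_centralS/center_projP h; rewrite addnS.
apply/upper_centralS/center_projP => c.
by move=> z /(@proj_commutators _ I)/h/IH.
Qed.

Section Nil.
Variables (B : skewBraceType) (hB : Dedekind B) (nB : star_nil B).
Implicit Types (a c x y : B).

(** Modulo <p a> the element a is central by [prime_order_center], so its
    commutators are multiples of p a, to which induction applies. *)
Lemma ppower_upper_central p i a : prime p -> star a a = 0 ->
  a *+ (p ^ i) = 0 -> ideal_set (upper_central B i) a.
Proof.
move=> pp; elim: i a => [|i IH] a aa; first by rewrite expn0 nmul1 => ->.
move=> pa; pose b := a *+ p.
have bb : star b b = 0 by rewrite /b -star0_expg //; apply: star0_X.
have Zb : ideal_set (upper_central B i) b.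
  by apply: IH => //; rewrite /b -nmulA -expnS.
apply/upper_centralS/center_projP => c.
have bZ : gen b `<=` ideal_set (upper_central B i).
  exact: gen_min (ideal_sub _) Zb.
pose I := gen_ideal hB b.
have : center (brace_proj I a).
  apply: (@prime_order_center p) => //.
  - exact: Dedekind_quotient.
  - exact: star_nil_quotient.
  - by rewrite -proj_star aa.
  - by rewrite -proj_nmul; apply/proj_eq0; apply: mem_gen.
by move=> /center_projP/(_ c) h y /h/bZ.
Qed.

(** If c is torsion, <c> is finite. Otherwise <c> is infinite cyclic modulo the
    finite ideal <c * c>, which thus contains the torsion elements of <c>. *)
Lemma gen_torsion_exponent c : exists2 M, (0 < M)%N &
  forall y, gen c y -> torsion y -> y *+ M = 0.
Proof.
have fin (S : set B) : finite_set S -> S `<=` @torsion B ->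
    (forall y, gen c y -> torsion y -> S y) -> exists2 M, (0 < M)%N &
    forall y, gen c y -> torsion y -> y *+ M = 0.
  move=> fS tS cS.
  have [M M0 hM] := finite_exponent fS (fun y Sy => torsion_nmul (tS y Sy)).
  by exists M => // y gy ty; apply/hM/cS.
have hT := torsion_sub hB.
have [tc|ntc] := pselect (torsion c).
  by apply: (fin (gen c)) => //; apply: gen_min.
have tcc : torsion (star c c) by apply: star_gen_finite.
apply: (fin (gen (star c c))) => //; first exact: gen_min.
move=> y gy ty; pose I := gen_ideal hB (star c c); pose q := brace_proj I.
have qcc : star (q c) (q c) = 0.
  by rewrite -proj_star; apply/proj_eq0; apply: mem_gen.
have [n nE] : exists n, q y = q c *+ n \/ q y = - (q c *+ n).
  by apply: (gen_star0 qcc); apply: proj_gen.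
have [n0|n0] := posnP n.
  apply/(@proj_eq0 _ I); change (q y = 0).
  by case: nE => ->; rewrite n0 nmul0 ?oppb0.
case: ntc; have [m m0 ym] := torsion_nmul ty.
have : q (c *+ (n * m)) = 0.
  rewrite /q proj_nmul nmulA -/(q c); case: nE => nE.
    by rewrite -nE -proj_nmul ym.
  by rewrite -[_ *+ n]oppbK -nE nmulN -proj_nmul ym /= oppb0.
move/(@proj_eq0 _ I) => Rcnm.
have [k k0] : exists2 k, (0 < k)%N & c *+ (n * m) *+ k = 0.
  by apply: torsion_nmul; apply: gen_min Rcnm.
by rewrite -nmulA; apply: nmul_torsion => //; rewrite !muln_gt0 n0 m0.
Qed.

End Nil.

(** * Power maps of unbounded abelian p-groups *)

Lemma ppower_order_dvd (B : skewBraceType) (b : B) p L s : prime p ->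
  b *+ (p ^ L) = 0 -> b *+ (p ^ L.-1) <> 0 -> b *+ (s * p) = 0 ->
  (p ^ L.-1 %| s)%N.
Proof.
move=> pp bL bL1 bs; have [->|s0] := posnP s; first exact: dvdn0.
rewrite pfactor_dvdn // leqNgt; apply/negP => vL; apply: bL1.
have [m cpm sE] := pfactor_coprime pp s0.
have bv : b *+ (p ^ (logn p s).+1) = 0.
  apply: (@coprime_nmul_eq0 _ _ m (p ^ L)).
  - by rewrite coprime_sym coprimeXl.
  - rewrite -nmulA; have -> // : (p ^ (logn p s).+1 * m = s * p)%N.
    by rewrite [in RHS]sE expnS; ring.
  - by rewrite nmulAC bL nmul0b.
by rewrite -(subnKC vL) expnD nmulA bv nmul0b.
Qed.

Section PowerMap.
Variables (B : skewBraceType) (A : set B) (p : nat) (phi : B -> B) (M : nat).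
Implicit Types a b x y : B.
Hypotheses (pp : prime p) (hA : is_sub_skew_brace A) (abA : is_abelian A).
Hypothesis phiD : forall a b, A a -> A b -> phi (a + b) = phi a + phi b.
Hypothesis phi_gen : forall a, A a -> gen a (phi a - a).
Hypothesis M0 : (0 < M)%N.
Hypothesis phiM : forall a e, A a -> a *+ (p ^ e) = 0 -> (phi a - a) *+ M = 0.
Hypothesis unbounded :
  forall k, exists a e, [/\ A a, a *+ (p ^ e) = 0 & a *+ (p ^ k) <> 0].

Let tA : is_trivial A. Proof. by case: abA. Qed.
Let cA a b : A a -> A b -> a + b = b + a. Proof. by case: abA => _; apply. Qed.

Lemma abelian_star0 a : A a -> star a a = 0.
Proof. by move=> Aa; apply: (trivial_star0 tA). Qed.

Lemma abelian_gen a y : A a -> gen a y -> A y.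
Proof. by move=> Aa; apply: gen_min. Qed.

Lemma abelian_nmulD a b n : A a -> A b -> (a + b) *+ n = a *+ n + b *+ n.
Proof.
move=> Aa Ab; apply: (@expgMn (additive_group B)).
exact: cA.
Qed.

Let delta a := phi a - a.

Lemma deltaD a b : A a -> A b -> delta (a + b) = delta a + delta b.
Proof.
move=> Aa Ab; have Ad := abelian_gen Ab (phi_gen Ab).
have AN y : A y -> A (- y) by apply: (sbrN hA).
rewrite /delta phiD // !addE -(baddA (phi a) (- a)) -baddA; congr (_ + _).
by rewrite baddA (@cA (- a)) //; exact: AN.
Qed.

Lemma deltaMn a n : A a -> delta (a *+ n) = delta a *+ n.
Proof.
move=> Aa; elim: n => [|n IH]; last first.
  by rewrite !nmulS deltaD ?IH //; apply: (sbrMn hA).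
apply: (@baddI _ (delta 0)); rewrite -deltaD ?addE //; exact: (sbr0 hA).
Qed.

Lemma torsion_gen_nmul a y n : (0 < n)%N -> a *+ n = 0 -> A a -> gen a y ->
  exists t, y = a *+ t.
Proof.
move=> n0 an Aa /(gen_star0 (abelian_star0 Aa))[k [|] ->]; first by exists k.
exists (n.-1 * k)%N; apply: (@baddI _ (a *+ k)); rewrite baddNr -nmulD.
by rewrite -mulSn prednK // nmulA an nmul0b.
Qed.

(** Elements M b with b of large order: they retain a large order, and
    delta (M b) = M delta b = 0. *)
Lemma delta_ker_unbounded k : exists a L, [/\ A a, delta a = 0, (k < L)%N,
  a *+ (p ^ L) = 0 & a *+ (p ^ L.-1) <> 0].
Proof.
have [a [e [Aa ae nak]]] := unbounded (logn p M + k).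
pose b := a *+ M; have Ab : A b by apply: (sbrMn hA).
have be : b *+ (p ^ e) = 0 by rewrite /b nmulAC ae nmul0b.
have bk : b *+ (p ^ k) <> 0.
  move=> bk; apply: nak; have [m cpm mE] := pfactor_coprime pp M0.
  apply: (@coprime_nmul_eq0 _ _ m (p ^ e)).
  - by rewrite coprime_sym coprimeXl.
  - rewrite -nmulA; have -> : (p ^ (logn p M + k) * m = M * p ^ k)%N.
      by rewrite [in RHS]mE expnD mulnC mulnA.
    by rewrite nmulA.
  - by rewrite nmulAC ae nmul0b.
have ex : exists e, `[< b *+ (p ^ e) = 0 >] by exists e; apply/asboolP.
case: (ex_minnP ex) => L /asboolP bL minL; exists b, L; split=> //.
- by rewrite /b deltaMn //; exact: phiM ae.
- rewrite ltnNge; apply/negP => Lk; apply: bk.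
  by rewrite -(subnKC Lk) expnD nmulA bL nmul0b.
- case: L bL minL => [|L] bL minL /=.
    by move=> _; apply: bk; rewrite -(nmul1 b) -(expn0 p) bL nmul0b.
  by move=> /asboolP/minL; rewrite ltnn.
Qed.

(** Let a be of minimal order with delta a <> 0; then delta a has order p. Take
    a' of larger order with delta a' = 0. Since delta a = delta (a + a') is a
    multiple of a + a' and has order p, it is a multiple of a'. Both <a> and
    <a'> thus have the subgroup generated by delta a as their subgroup of order
    p, so subtracting from a a suitable multiple a'' of a' lowers the order of
    a without changing its image under delta: a contradiction. *)
Lemma power_map_trivial a e : A a -> a *+ (p ^ e) = 0 -> phi a = a.
Proof.
move=> Aa ae; suff: delta a = 0 by apply: addb_eq0.
elim: e a Aa ae => [|m IH] a Aa ae.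
  move: ae; rewrite expn0 nmul1 => ->.
  by rewrite -(nmul0 0) deltaMn //; apply: (sbr0 hA).
apply: contrapT => da0.
have pda : delta a *+ p = 0.
  rewrite -deltaMn //; apply: IH; first exact: (sbrMn hA).
  by rewrite -nmulA -expnS.
have [a' [L [Aa' da' mL a'L a'L1]]] := delta_ker_unbounded m.+1.
have [l LE] : exists l, L.-1 = (l + m.+1)%N.
  by exists (L.-1 - m.+1)%N; rewrite subnK //; case: (L) mL.
have Aaa : A (a + a') by apply: (sbrD hA).
have L0 : L = L.-1.+1 by case: (L) mL.
have kill n : a *+ (p ^ (n + m.+1)) = 0 by rewrite addnC expnD nmulA ae nmul0b.
have aaL : (a + a') *+ (p ^ L) = 0.
  by rewrite abelian_nmulD // a'L L0 LE -addSn kill !addE.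
have daa : delta (a + a') = delta a by rewrite deltaD // da' !addE.
have [s sE] : exists s, delta a = (a + a') *+ s.
  apply: (torsion_gen_nmul _ aaL) => //; first by rewrite expn_gt0 prime_gt0.
  by rewrite -daa; apply: phi_gen.
have pLs : (p ^ L.-1 %| s)%N.
  apply: (ppower_order_dvd pp aaL); last by rewrite nmulA -sE.
  by rewrite abelian_nmulD // LE kill badd0l -LE.
have [s' sE'] : exists s', s = (p ^ L.-1 * s')%N.
  by case/dvdnP: pLs => s' ->; exists s'; rewrite mulnC.
(* The factor p ^ L.-1 of s kills a, so only the multiple of a' remains. *)
have dE : delta a = a' *+ s.
  by rewrite sE abelian_nmulD // {1}sE' LE nmulA kill nmul0b !addE.
pose b := a *+ (p ^ m).
have bb : star b b = 0 by apply/abelian_star0/(sbrMn hA).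
have bp : b *+ p = 0 by rewrite /b -nmulA -expnSr.
have gb : gen b (delta a).
  have pm0 : (0 < p ^ m.+1)%N by rewrite expn_gt0 prime_gt0.
  have [t tE] : exists t, delta a = a *+ t.
    exact: torsion_gen_nmul pm0 ae Aa (phi_gen Aa).
  have /dvdnP[t' t'E] : (p ^ m %| t)%N.
    apply: (ppower_order_dvd pp ae) => /=; last by rewrite nmulA -tE.
    by move=> am; apply: da0; apply: IH.
  rewrite tE t'E mulnC nmulA; apply: (sbrMn (gen_sub b)); exact: mem_gen.
have [k kE] := prime_gen_sym pp bp bb gb da0.
pose a'' := a' *+ (p ^ l * p * s' * k).
have bE : b = a'' *+ (p ^ m).
  rewrite kE dE sE' LE /a'' -!nmulA; congr (a' *+ _).
  by rewrite expnD expnS; ring.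
have Aa'' : A a'' by apply: (sbrMn hA).
have AN : A (- a'') by apply: (sbrN hA).
have da'' : delta a'' = 0 by rewrite /a'' deltaMn // da' nmul0b.
have dN : delta (- a'') = 0.
  apply: (@baddI _ (delta a'')); rewrite -deltaD // baddNr da''.
  by rewrite -(nmul0 a'') deltaMn // nmul0 !addE.
apply: da0; have -> : delta a = delta (a - a'') by rewrite deltaD // dN badd0r.
apply: IH.
  exact: (sbrD hA).
by rewrite abelian_nmulD // nmulN -bE baddNr.
Qed.
End PowerMap.

(** * Periodic abelian ideals, and central nilpotency *)

Section PeriodicAbelian.
Variables (B : skewBraceType) (hB : Dedekind B) (nB : star_nil B).
Variables (A : set B).
Hypotheses (hA : is_sub_skew_brace A) (abA : is_abelian A).
Implicit Types a c : B.

Let IA := ded_ideal hB hA.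

(** A component of bounded exponent p ^ k lies in the k-th centre by
    [ppower_upper_central]. In the unbounded case [power_map_trivial] is applied
    to lam_c, to additive and to multiplicative conjugation by c; the bound on
    the order of their commutators comes from [gen_torsion_exponent]. *)
Lemma periodic_abelian_primary p : prime p ->
  exists k, forall a e,
    A a -> a *+ (p ^ e) = 0 -> ideal_set (upper_central B k) a.
Proof.
move=> pp.
have [[k hk]|unb] := pselect (exists k, forall a e,
    A a -> a *+ (p ^ e) = 0 -> a *+ (p ^ k) = 0).
  exists k => a e Aa ae; apply: (ppower_upper_central hB nB pp) (hk a e Aa ae).
  exact: (abelian_star0 abA).
have {}unb k : exists a e, [/\ A a, a *+ (p ^ e) = 0 & a *+ (p ^ k) <> 0].
  apply: contrapT => h; apply: unb; exists k => a e Aa ae.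
  by apply: contrapT => ak; apply: h; exists a, e.
exists 1%N => a e Aa ae; apply/upper_centralS.
have cD x y : A x -> A y -> x + y = y + x by case: abA => _; apply.
have tD x y : A x -> A y -> x + y = x * y by case: abA => + _; apply.
suff /centerE ac : forall c, cent a c.
  move: ac => /centerE ac; apply/centerE => C; have [c ->] := projP C.
  have [h1 h2 h3] := ac c.
  by split; rewrite -?proj_lam -?brace_projD -?brace_projM ?h1 ?h2 ?h3.
move=> c; have [M M0 hM] := gen_torsion_exponent hB nB c.
have kill phi : (forall x y, A x -> A y -> phi (x + y) = phi x + phi y) ->
    (forall x, A x -> gen x (phi x - x)) ->
    (forall x, A x -> gen c (phi x - x)) -> phi a = a.
  move=> phiD phix phic.
  apply: (power_map_trivial pp hA abA phiD phix M0 _ unb Aa ae).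
  move=> x i Ax xi; apply: hM; first exact: phic.
  apply: gen_min (phix x Ax); first exact: torsion_sub.
  by apply: (nmul_torsion hB nB) xi; rewrite expn_gt0 prime_gt0.
have AX x : A x -> A (x ^ c) by apply: (@ideal_conjg _ IA).
apply/cent_act; split.
- apply: kill => [x y _ _|x Ax|x Ax]; first exact: lamD.
    by apply: gen_starr => //; apply: mem_gen.
  by apply: gen_starl => //; apply: mem_gen.
- apply: (kill (fun x => - c + (x + c))) => [x y _ _|x Ax|x Ax].
  + by rewrite -!baddA !addE.
  + apply: (sbrD (gen_sub x)); first by apply: gen_conj => //; apply: mem_gen.
    by apply: (sbrN (gen_sub x)); apply: mem_gen.
  + rewrite -!baddA; apply: (sbrD (gen_sub c)).
      by apply: (sbrN (gen_sub c)); apply: mem_gen.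
    by apply: gen_conjN => //; apply: mem_gen.
- apply: (kill (fun x => x ^ c)) => [x y Ax Ay|x Ax|x Ax].
  + by rewrite tD // conjMg -tD //; apply: AX.
  + apply: (sbrD (gen_sub x)); first by apply: gen_conjg => //; apply: mem_gen.
    by apply: (sbrN (gen_sub x)); apply: mem_gen.
  + have -> : x ^ c - x = x ^ c * x^-1.
      have -> : x^-1 = - x; last first.
        by rewrite -tD //; [apply: AX|apply: (sbrN hA)].
      apply: (@mulgI _ x); rewrite mulgV -tD ?baddNr ?zero_one //.
      exact: (sbrN hA).
    have -> : x ^ c * x^-1 = c^-1 * (c ^ x^-1) by rewrite !conjgE invgK !mulgA.
    apply: (sbrM (gen_sub c)).
      by apply: (sbrV (gen_sub c)); apply: mem_gen.
    by apply: gen_conjg => //; apply: mem_gen.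
Qed.

Hypothesis periodicA : forall a, A a -> exists2 n, (0 < n)%N & a *+ n = 0.
Variable P : nat.
Hypothesis primesA :
  forall a p, A a -> prime p -> a *+ p = 0 -> a <> 0 -> (p <= P)%N.

Lemma periodic_abelian_upper_central :
  exists k, forall a, A a -> ideal_set (upper_central B k) a.
Proof.
have [K hK] : exists K, forall p, prime p -> (p <= P)%N -> forall a e, A a ->
    a *+ (p ^ e) = 0 -> ideal_set (upper_central B K) a.
  elim: P => [|N [K hK]].
    by exists 0%N => p pp; rewrite leqn0 => /eqP p0; rewrite p0 in pp.
  have [pN|npN] := boolP (prime N.+1); last first.
    exists K => p pp; rewrite leq_eqVlt => /orP[/eqP pE|pN]; last exact: hK.
    by rewrite pE (negbTE npN) in pp.
  have [k hk] := periodic_abelian_primary pN.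
  exists (maxn K k) => p pp; rewrite leq_eqVlt => /orP[/eqP pE|lt] a e Aa ae.
    by apply: upper_central_le (hk a e Aa _); rewrite ?leq_maxr // -pE.
  by apply: upper_central_le (hK p pp lt a e Aa ae); rewrite leq_maxl.
have Kp p a e :
    prime p -> A a -> a *+ (p ^ e) = 0 -> ideal_set (upper_central B K) a.
  move=> pp; case: (leqP p P) => [|Pp]; first by move=> h; apply: hK.
  move=> Aa; elim: e => [|e IH] ae.
    by move: ae; rewrite expn0 nmul1 => ->; apply: (sbr0 (ideal_sub _)).
  apply: IH; apply: contrapT => ne.
  suff : (p <= P)%N by rewrite leqNgt Pp.
  apply: (@primesA (a *+ (p ^ e))) => //; first exact: (sbrMn hA).
  by rewrite -nmulA -expnSr.
exists K => a Aa; have [n n0 an] := periodicA Aa.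
elim/ltn_ind: n => n IH in a Aa n0 an *.
have [n1|n1] := leqP n 1.
  have n1E : n = 1%N by apply/eqP; rewrite eqn_leq n1.
  by move: an; rewrite n1E nmul1 => ->; apply: (sbr0 (ideal_sub _)).
have pp := pdiv_prime n1; set p := pdiv n in pp.
have [m cpm nE] := pfactor_coprime pp n0; set l := logn p n in nE.
have l0 : (0 < l)%N by rewrite logn_gt0 mem_primes pp n0 pdiv_dvd.
have m0 : (0 < m)%N by move: n0; rewrite nE muln_gt0 => /andP[].
have mn : (m < n)%N.
  by rewrite nE ltn_Pmulr // -(expn0 p) ltn_exp2l // prime_gt1.
have cop : coprime m (p ^ l) by rewrite coprime_sym coprimeXl.
apply: (@coprime_expg_mem (additive_group B) _ a m (p ^ l)) => //.
- by case: (ideal_sub (upper_central B K)).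
- apply: (@Kp p (a *+ m) l) => //; first exact: (sbrMn hA).
  by rewrite -nmulA -nE.
- apply: (IH m mn (a *+ (p ^ l))) => //; first exact: (sbrMn hA).
  by rewrite -nmulA mulnC -nE.
Qed.
End PeriodicAbelian.

(** The terms T k are the torsion parts of a soluble series. A prime occurring
    in a factor of T k.+1 by T k occurs in both groups of B, because T k.+1 is
    periodic for both laws; so finiteness for one of them bounds these
    primes. *)
Lemma soluble_centrally_nilpotent (B : skewBraceType) (hB : Dedekind B) :
  soluble B ->
  finite_set (pi_group (additive_group B)) \/ finite_set (pi_group B) ->
  centrally_nilpotent B.
Proof.
move=> sB piB.
have nB := trivial_series_star_nil (soluble_trivial_series sB).
have [P hP] : exists P, forall p,
    pi_group (additive_group B) p -> pi_group B p -> (p <= P)%N.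
  have bd (S : set nat) : finite_set S -> exists P, forall p, S p -> (p <= P)%N.
    move=> /finite_seqP[s ->]; exists (\max_(i <- s) i)%N => p /= ps.
    exact: (@leq_bigmax_seq _ s xpredT (fun i => i)).
  by case: piB => /bd[P hP]; exists P => p h1 h2; apply: hP.
have hT := torsion_sub hB.
have [n [I [I0 In hI]]] := sB.
have hTk k : is_sub_skew_brace (ideal_set (I k) `&` @torsion B).
  have hk := ideal_sub (I k).
  apply: sub_braceP.
  - by split; [apply: (sbr0 hk)|apply: (sbr0 hT)].
  - by move=> x y [h1 h2] [h3 h4]; split; [apply: (sbrD hk)|apply: (sbrD hT)].
  - by move=> x [h1 h2]; split; [apply: (sbrN hk)|apply: (sbrN hT)].
  - by move=> x y [h1 h2] [h3 h4]; split; [apply: (sbrM hk)|apply: (sbrM hT)].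
  - by move=> x [h1 h2]; split; [apply: (sbrV hk)|apply: (sbrV hT)].
pose T k := ded_ideal hB (hTk k).
have [m hm] : exists m, ideal_set (T n) `<=` ideal_set (upper_central B m).
  have : (n <= n)%N by []; elim: {1 3}n => [|k IH] kn.
    by exists 0%N => x [+ _]; rewrite I0 => ->.
  have [m hm] := IH (ltnW kn).
  have [_ /factor_abelianP[/factor_trivialP tk ck]] := hI k kn.
  have hA := im_sub (T k) (ideal_sub (T k.+1)).
  have abA : is_abelian (factor (T k) (ideal_set (T k.+1))).
    apply/factor_abelianP; split; first apply/factor_trivialP.
      move=> a b [Ia ta] [Ib tb]; split; first exact: tk.
      apply: (sbrD hT); last exact: (sbrM hT).
      by apply: (sbrN hT); apply: (sbrD hT).
    move=> a b [Ia ta] [Ib tb]; split; first exact: ck.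
    by apply: (sbrD hT); [apply: (sbrN hT)|]; apply: (sbrD hT).
  have hQ := Dedekind_quotient (I := T k) hB.
  have nQ := star_nil_quotient (T k) nB.
  have [|_ p [x Tx <-] pp xp x0|j hj] :=
    @periodic_abelian_upper_central _ hQ nQ _ hA abA _ P.
  - move=> _ [x [_ tx] <-]; have [i i0 xi] := torsion_nmul tx.
    by exists i => //; rewrite -proj_nmul xi.
  - have [_ tx] := Tx; have nx : ~ ideal_set (T k) x by move=> /proj_eq0.
    have hTs := ideal_sub (T k).
    apply: hP.
      have [i i0 xi] := torsion_nmul tx.
      apply: (@pi_group_quotient (additive_group B) (ideal_set (T k)) x p i)
        => //.
        by case: hTs.
      by apply/(@proj_eq0 _ (T k)); rewrite -[_ ^+ p]/(x *+ p) proj_nmul.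
    have [i i0 xi] := torsion_expg tx.
    apply: (@pi_group_quotient B (ideal_set (T k)) x p i) => //.
      by case: hTs.
    apply/(@proj_eq0 _ (T k)); rewrite projX star0_expg //.
    by apply: (abelian_star0 abA); exists x.
  exists (m + j)%N => x Tx; apply: (@upper_central_quotient _ (T k) m hm).
  by apply: hj; exists x.
exists m.+1; apply/seteqP; split=> // x _.
apply/upper_centralS/center_projP => c.
have /center_projP/(_ c) h := torsion_quotient_central hB nB x.
by move=> y /h ty; apply: hm; split=> //; rewrite In.
Qed.

Lemma has_order_inj (G : groupType) (x : G) m n :
  has_order x m -> has_order x n -> m = n.
Proof.
move=> [m0 xm hm] [n0 xn hn]; case: (ltngtP m n) => // lt.
- by case: (hn m) => //; rewrite m0.
- by case: (hm n) => //; rewrite n0.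
Qed.

Lemma pgroup_finite_pi (G : groupType) p :
  prime p -> is_pgroup p G -> finite_set (pi_group G).
Proof.
move=> pp hG; apply: sub_finite_set (finite_set1 p) => q [qp [x xq]].
have [k xk] := hG x; have qE := has_order_inj xq xk.
have : (q %| p ^ k)%N by rewrite qE.
by rewrite Euclid_dvdX // dvdn_prime2 // => /andP[/eqP].
Qed.

Theorem corollary3p9 (B : skewBraceType) (hB : Dedekind B) :
  (soluble B \/ left_nilpotent B \/ right_nilpotent B ->
     has_trivial_ideal_series B) /\
  (has_trivial_ideal_series B ->
     soluble B /\
     (finite_set (pi_group (additive_group B)) \/ finite_set (pi_group B) ->
        finite_Hirsch_length (additive_group B) ->
        centrally_nilpotent B) /\
     (forall p : nat, prime p ->
        is_pgroup p (additive_group B) \/ is_pgroup p B ->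
        centrally_nilpotent B)).
Proof.
split=> [[|]|hT]; first exact: soluble_trivial_series.
  exact: nilpotent_trivial_series.
have sB := trivial_series_soluble hB hT; split=> //; split.
  by move=> piB _; apply: soluble_centrally_nilpotent.
move=> p pp hp; apply: soluble_centrally_nilpotent => //.
by case: hp => /(pgroup_finite_pi pp); [left|right].
Qed.
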